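(* Let $\mathbb K$ be an algebraically closed field of characteristic $0$. Let $K_1,K_2,L$ be non-negative integers and let $\Sigma_1,\Sigma_2,\Sigma_3$ be finite subsets of the group $G=\mathbb K^2\times\mathbb K^\times$. Assume that $\Sigma_1,\Sigma_2,\Sigma_3$ contain the origin $(0,0,1)$ of $G$ and that: \begin{enumerate} \item[(i)] for all $(a,b)\in\mathbb K^2\setminus\{(0,0)\}$, $$\mathrm{Card}\{ax_1+bx_2:\ \exists y\in\mathbb K^\times \text{ with }(x_1,x_2,y)\in\Sigma_1\}>\max\{K_1,K_2\},$$ and $$\mathrm{Card}\{y:\ \exists (x_1,x_2)\in\mathbb K^2\text{ with }(x_1,x_2,y)\in\Sigma_1\}>L;$$ \item[(ii)] for all $(a,b)\in\mathbb K^2\setminus\{(0,0)\}$, $$\mathrm{Card}\{(ax_1+bx_2,y):\ (x_1,x_2,y)\in\Sigma_2\}>2\max\{K_1,K_2\}L,$$ and $$\mathrm{Card}\{(x_1,x_2):\ \exists y\in\mathbb K^\times\text{ with }(x_1,x_2,y)\in\Sigma_2\}>2K_1K_2;$$ \item[(iii)] $\mathrm{Card}\,\Sigma_3>6K_1K_2L$. \end{enumerate} Let $s$ be a non-zero polynomial of $\mathbb K[X_1,X_2,Y]$ whose partial degrees in the variables $X_1$, $X_2$ and $Y$ are bounded by $K_1$, $K_2$ and $L$, respectively. Then $s$ does not vanish identically on the set $\Sigma_1+\Sigma_2+\Sigma_3$.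
   Context: The group $G=\mathbb K^2\times\mathbb K^\times$ (product of the additive group $\mathbb K^2$ and the multiplicative group $\mathbb K^\times$) has its composition law written additively: $(x_1,x_2,y)+(x_1',x_2',y')=(x_1+x_1',x_2+x_2',yy')$, and $\Sigma_1+\Sigma_2+\Sigma_3=\{\sigma_1+\sigma_2+\sigma_3:\sigma_i\in\Sigma_i\}$. *)

(* Defs.v *)
From HB Require Import structures.
From mathcomp Require Import all_boot all_order all_algebra.
From mathcomp Require Import finmap mpoly.

Set Implicit Arguments.
Unset Strict Implicit.
Unset Printing Implicit Defensive.

Import GRing.Theory.
Local Open Scope fset_scope.
Local Open Scope ring_scope.

(* The multiplicative group of K, as a zmodType: its addition is the product
   of K and its zero is 1. The product structure on K * K * mulgrp K is then
   the additively written group law of K^2 x K^*, with origin (0, 0, 1). *)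
Definition mulgrp (K : fieldType) : Type := {y : K | y != 0}.

HB.instance Definition _ (K : fieldType) :=
  SubChoice.copy (mulgrp K) {y : K | y != 0}.

Section MulGrp.
Variable K : fieldType.
Implicit Types u v w : mulgrp K.

Definition mulgrp_one : mulgrp K := Sub 1 (oner_neq0 K).

Definition mulgrp_mul u v : mulgrp K :=
  Sub (val u * val v) (mulf_neq0 (valP u) (valP v)).

Fact mulgrp_inv_subproof u : (val u)^-1 != 0.
Proof. by rewrite invr_eq0 (valP u). Qed.

Definition mulgrp_inv u : mulgrp K := Sub (val u)^-1 (mulgrp_inv_subproof u).

Fact mulgrp_mulA : associative mulgrp_mul.
Proof. by move=> u v w; apply: val_inj; rewrite /= mulrA. Qed.

Fact mulgrp_mulC : commutative mulgrp_mul.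
Proof. by move=> u v; apply: val_inj; rewrite /= mulrC. Qed.

Fact mulgrp_mul1 : left_id mulgrp_one mulgrp_mul.
Proof. by move=> u; apply: val_inj; rewrite /= mul1r. Qed.

Fact mulgrp_mulV : left_inverse mulgrp_one mulgrp_inv mulgrp_mul.
Proof. by move=> u; apply: val_inj; rewrite /= mulVf // (valP u). Qed.

HB.instance Definition _ := GRing.isZmodule.Build (mulgrp K)
  mulgrp_mulA mulgrp_mulC mulgrp_mul1 mulgrp_mulV.

End MulGrp.

Notation grpG K := (K * K * mulgrp K)%type.

Section Coordinates.
Variable K : fieldType.
Implicit Types g h : grpG K.

Definition coordX1 g : K := g.1.1.
Definition coordX2 g : K := g.1.2.
Definition coordY g : K := val g.2.

Lemma coordD g h :
  [/\ coordX1 (g + h) = coordX1 g + coordX1 h,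
      coordX2 (g + h) = coordX2 g + coordX2 h
    & coordY (g + h) = coordY g * coordY h].
Proof. by []. Qed.

Lemma coord0 :
  [/\ coordX1 (0 : grpG K) = 0, coordX2 (0 : grpG K) = 0
    & coordY (0 : grpG K) = 1].
Proof. by []. Qed.

(* The variables 'X_0, 'X_1, 'X_2 of {mpoly K[3]} are X_1, X_2, Y. *)
Definition coords g : 'I_3 -> K :=
  tnth [tuple coordX1 g; coordX2 g; coordY g].

End Coordinates.

Definition sumset (V : zmodType) (A B : {fset V}) : {fset V} :=
  [fset a + b | a in A, b in B].

(* By convention the partial degrees of the zero polynomial are 0. *)
Definition pdeg (n : nat) (R : nzRingType) (i : 'I_n) (p : {mpoly R[n]}) :
    nat :=
  \max_(m <- msupp p) m i.

(* Main.v *)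
Require Import Defs.
From mathcomp Require Import all_boot all_order all_algebra.
From mathcomp Require Import finmap mpoly.
From mathcomp Require boolp classical_sets.
From mathcomp Require Import zify ring.

Set Implicit Arguments.
Unset Strict Implicit.
Unset Printing Implicit Defensive.

Import GRing.Theory.
Local Open Scope fset_scope.
Local Open Scope ring_scope.

(** Polynomials in X1, X2, Y are seen in R = K[x1][x2][y]. Let W1 and W2 be the
translates of s by S1 and by S1 + S2. If s vanishes on S1 + S2 + S3, then the
points of S3 are common zeros of W2. One shows that the common zeros of W1 in G
have dimension at most one and those of W2 dimension zero, and then S3 has at
most 6 K1 K2 L elements by a theorem of Bezout; this contradicts the hypothesis
on S3.

The theorem of Bezout has the form of [bezout_bound] and [bezout_primes]: if N
pairwise incomparable prime ideals contain a regular sequence of length r of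
polynomials whose degrees in x1, x2, y are at most K1, K2, L, and if none of them
contains a nonzero polynomial in a certain set of 3 - r variables, then N is at
most r! times the product of the degree bounds of the other variables. It is
proved by linear algebra. Products of powers of the elements of the sequence, of
monomials in the 3 - r variables, and of polynomials separating the prime ideals
are linearly independent, so there are at most as many of them as there are
monomials of the same degrees.

The regular sequence is s, sum_i T^i w_i over W1, and sum_j U^j w_j over W2, with
indeterminates T and U. By McCoy's theorem [mccoy], such a generic combination is
a zero divisor modulo an ideal only if one element outside of this ideal
multiplies all the w_i into it; this is excluded by the unmixedness of ideals
generated by a regular sequence ([principal_unmixed], [ideal2_unmixed_poly]) once
the ideals of W1 and W2 are known to be large enough.

If the common zeros of W1 have a component of dimension two, then there is a
prime ideal P over W1 that contains no nonzero polynomial in two of the variables,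
by Zorn's lemma ([prime_avoiding]). Its translates by S1 all contain s. Those
translations that map P into itself move x along a fixed line ([stab_line]), or
multiply y by roots of unity of bounded order when P contains no nonzero
polynomial in x1, x2 ([ex_eigenvector]); so the hypothesis on the projections of
S1 gives too many incomparable translates for the theorem of Bezout with r = 1
([ideal1_meets_y], [ideal1_meets_xx]). In the same way, a component of dimension
one of the common zeros of W2 has too many translates by S2 for the theorem with
r = 2 ([ideal2_meets_y], [ideal2_meets_x]). The case r = 3 bounds the number of
elements of S3 ([card_common_zeros]). *)

(** * Ideals, prime ideals and McCoy's theorem *)

Record is_ideal (A : comNzRingType) (I : A -> Prop) : Prop := IsIdeal {
  ideal0 : I 0;
  idealD : forall a b, I a -> I b -> I (a + b);
  idealM : forall a b, I b -> I (a * b) }.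

Record is_prime (A : comNzRingType) (P : A -> Prop) : Prop := IsPrime {
  prime_ideal :> is_ideal P;
  prime1 : ~ P 1;
  primeM : forall a b, P (a * b) -> P a \/ P b }.

Section Ideals.
Variable A : comNzRingType.
Implicit Types (I J P S : A -> Prop) (a b f : A).

Lemma idealN I a : is_ideal I -> I a -> I (- a).
Proof. by move=> idI Ia; rewrite -mulN1r; apply: idealM. Qed.

Lemma idealB I a b : is_ideal I -> I a -> I b -> I (a - b).
Proof. by move=> idI Ia Ib; apply: (idealD idI) => //; apply: idealN. Qed.

Lemma ideal_sum I (J : Type) (r : seq J) (Q : pred J) (F : J -> A) :
  is_ideal I -> (forall j, Q j -> I (F j)) -> I (\sum_(j <- r | Q j) F j).
Proof.
move=> idI IF; apply: (big_ind I) => //; first exact: ideal0.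
exact: (idealD idI).
Qed.

Lemma primeX P a k : is_prime P -> P (a ^+ k) -> P a.
Proof.
move=> prP; elim: k => [|k IHk]; first by rewrite expr0 => /(prime1 prP).
by rewrite exprS => /(primeM prP) [].
Qed.

Lemma prime_sum_single P (J : finType) (i : J) (F : J -> A) :
  is_ideal P -> (forall j, j != i -> P (F j)) -> P (\sum_j F j) -> P (F i).
Proof.
move=> idP PF; rewrite (bigD1 i) //= => PS.
have -> : F i = F i + \sum_(j | j != i) F j - \sum_(j | j != i) F j.
  by rewrite addrK.
by apply: (idealB idP PS); apply: ideal_sum.
Qed.

Lemma zero_ideal : is_ideal (fun a : A => a = 0).
Proof.
by split=> // [a b -> ->|a b ->]; rewrite ?addr0 ?mulr0.
Qed.

Definition principal f a := exists c, a = c * f.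

Lemma principal_ideal f : is_ideal (principal f).
Proof.
split=> [|a b [c ->] [d ->]|a b [c ->]]; first by exists 0; rewrite mul0r.
  by exists (c + d); rewrite mulrDl.
by exists (a * c); rewrite mulrA.
Qed.

Definition generated (W : seq A) a :=
  forall I, is_ideal I -> (forall w, w \in W -> I w) -> I a.

Lemma generated_ideal W : is_ideal (generated W).
Proof.
split=> [I idI _|a b Ga Gb I idI IW|a b Gb I idI IW].
- exact: ideal0.
- by apply: (idealD idI); [apply: Ga | apply: Gb].
- by apply: (idealM idI); apply: Gb.
Qed.

Lemma generated_colon W I f a :
  is_ideal I -> (forall w, w \in W -> I (f * w)) -> generated W a -> I (f * a).
Proof.
move=> idI IW /(_ (fun b => I (f * b))); apply=> //.
split=> [|b c Ib Ic|b c Ic]; first by rewrite mulr0; apply: ideal0.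
  by rewrite mulrDr; apply: (idealD idI).
by rewrite mulrCA; apply: (idealM idI).
Qed.

(** By Zorn's lemma: an ideal that is maximal among those containing the given
one and missing the multiplicative set is prime. *)
Lemma prime_avoiding I S :
    is_ideal I -> S 1 -> (forall a b, S a -> S b -> S (a * b)) ->
    (forall a, I a -> ~ S a) ->
  exists P, [/\ is_prime P, forall a, I a -> P a & forall a, P a -> ~ S a].
Proof.
move=> idI S1 SM IS.
(* The predicate also accepts the empty set, which is the union of the empty
   chain. *)
pose good J := (forall a, ~ J a) \/
  [/\ is_ideal J, forall a, I a -> J a & forall a, J a -> ~ S a].
have [|M [goodM maxM]] := @classical_sets.Zorn_bigcup A good.
  move=> F Fgood Ftot; pose U := classical_sets.bigcup F id.
  case: (boolp.EM (exists J, F J /\ exists a, J a)) => [[J0 [FJ0 [a0 J0a0]]]|noF].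
    have idF J a : F J -> J a ->
        [/\ is_ideal J, forall a, I a -> J a & forall a, J a -> ~ S a].
      by move=> FJ Ja; case: (Fgood J FJ) => [/(_ a)|].
    right; split.
    - split.
      + by exists J0 => //; apply: ideal0; case: (idF _ _ FJ0 J0a0).
      + move=> a b [J FJ Ja] [J' FJ' J'b].
        case: (Ftot J J' FJ FJ') => sub.
          exists J' => //; case: (idF _ _ FJ' J'b) => idJ' _ _.
          exact: (idealD idJ' (sub _ Ja) J'b).
        exists J => //; case: (idF _ _ FJ Ja) => idJ _ _.
        exact: (idealD idJ Ja (sub _ J'b)).
      + move=> a b [J FJ Jb]; exists J => //.
        by case: (idF _ _ FJ Jb) => idJ _ _; apply: (idealM idJ).
    - by move=> a Ia; exists J0 => //; case: (idF _ _ FJ0 J0a0) => _ + _; apply.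
    - by move=> a [J FJ Ja]; case: (idF _ _ FJ Ja) => _ _; apply.
  by left=> a [J FJ Ja]; apply: noF; exists J; split=> //; exists a.
have {goodM} [idM IM MS] : [/\ is_ideal M, forall a, I a -> M a
    & forall a, M a -> ~ S a].
  case: goodM => // M0; case: (maxM I); last by right.
  split; first by move=> a /M0.
  by move=> sub; apply: (M0 0); apply: sub; apply: ideal0.
have ext a : ~ M a -> exists b c, M b /\ S (b + c * a).
  move=> Ma; apply: boolp.contrapT => noS.
  pose N x := exists b c, M b /\ x = b + c * a.
  case: (maxM N).
    split; first by move=> x Mx; exists x, 0; rewrite mul0r addr0.
    move=> sub; apply: Ma; apply: sub; exists 0, 1.
    by rewrite add0r mul1r; split=> //; apply: ideal0.
  right; split.
  - split.
    + by exists 0, 0; rewrite mul0r addr0; split=> //; apply: ideal0.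
    + move=> _ _ [b [c [Mb ->]]] [b' [c' [Mb' ->]]]; exists (b + b'), (c + c').
      by split; [exact: (idealD idM) | rewrite mulrDl addrACA].
    + move=> d _ [b [c [Mb ->]]]; exists (d * b), (d * c).
      by split; [exact: (idealM idM) | rewrite mulrDr mulrA].
  - by move=> x Ix; exists x, 0; rewrite mul0r addr0; split=> //; apply: IM.
  - by move=> x [b [c [Mb ->]]] Sx; apply: noS; exists b, c.
exists M; split=> //; split=> // [M1|a b Mab]; first exact: (MS 1).
apply: boolp.contrapT => /boolp.not_orP [/ext [x [c [Mx Sx]]] /ext [y [d [My Sy]]]].
apply: (MS _ _ (SM _ _ Sx Sy)).
have -> : (x + c * a) * (y + d * b) =
    (y + d * b) * x + ((c * a) * y + (c * d) * (a * b)) by ring.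
by apply: (idealD idM); [apply: (idealM idM)|apply: (idealD idM); apply: (idealM idM)].
Qed.

End Ideals.

Section CoefIdeal.
Variable A : comNzRingType.
Implicit Types I : A -> Prop.

Definition coef_ideal I (p : {poly A}) := forall i, I p`_i.

Lemma coef_idealP I : is_ideal I -> is_ideal (coef_ideal I).
Proof.
move=> idI; split=> [i|p q Ip Iq i|p q Iq i].
- by rewrite coef0; apply: ideal0.
- by rewrite coefD; apply: (idealD idI).
- by rewrite coefM; apply: ideal_sum => // j _; apply: (idealM idI).
Qed.

(** McCoy's theorem modulo an ideal: a polynomial is a zero divisor only if a
nonzero constant kills it. This makes a polynomial with indeterminate
coefficients as regular as a general element of a linear system would be. *)
Lemma mccoy I (f g : {poly A}) :
    is_ideal I -> (forall c, (forall i, I (c * f`_i)) -> I c) ->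
  coef_ideal I (f * g) -> coef_ideal I g.
Proof.
move=> idI regf; have idC := coef_idealP idI.
elim: {g}(size g) {-2}g (leqnn (size g)) => [|n IHn] g szg Ifg.
  move: szg; rewrite leqn0 size_poly_eq0 => /eqP ->; exact: (ideal0 idC).
suff If i : coef_ideal I (f`_i *: g).
  move=> k; apply: regf => i; rewrite mulrC; have := If i k.
  by rewrite coefZ.
(* Descending induction on i, the top coefficient of f_i g being congruent to
   a coefficient of f g. *)
elim: {i}(size f - i)%N {-2}i (leqnn (size f - i)%N) => [|m IHm] i le_fi.
  move: le_fi; rewrite leqn0 subn_eq0 => le_fi.
  by rewrite nth_default // scale0r; apply: (ideal0 idC).
case: (ltnP i (size f)) => [lt_if|le_fi']; last first.
  by rewrite nth_default // scale0r; apply: (ideal0 idC).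
have Ihigh j : (i < j)%N -> coef_ideal I (f`_j *: g).
  by move=> lt_ij; apply: IHm; move: le_fi lt_if lt_ij; lia.
have Itop : I (f`_i * g`_n).
  have := Ifg (i + n)%N; rewrite coefM.
  have lt_i : (i < (i + n).+1)%N by lia.
  move/(prime_sum_single (i := Ordinal lt_i) idI) => /=.
  rewrite addKn; apply=> j neq_ji; case: (ltngtP j i) => [lt_ji|lt_ij|eq_ji].
  - rewrite (nth_default 0 (_ : size g <= (i + n) - j)%N) ?mulr0.
      exact: ideal0.
    by move: szg lt_ji; lia.
  - by have := Ihigh _ lt_ij (i + n - j)%N; rewrite coefZ.
  - by case/eqP: neq_ji; apply: val_inj.
pose g' : {poly A} := f`_i *: g - (f`_i * g`_n) *: 'X^n.
have g'E : f`_i *: g = g' + (f`_i * g`_n) *: 'X^n by rewrite subrK.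
have ItopX : coef_ideal I ((f`_i * g`_n) *: 'X^n).
  by move=> k; rewrite coefZ mulrC; apply: (idealM idI).
rewrite g'E; apply: (idealD idC) => //; apply: IHn.
  apply/leq_sizeP => k le_nk; rewrite coefB !coefZ coefXn.
  case: (eqVneq k n) => [->|neq_kn]; first by rewrite mulr1 subrr.
  rewrite mulr0 subr0 [g`_k]nth_default ?mulr0 //; apply: leq_trans szg _.
  by rewrite ltn_neqAle eq_sym neq_kn.
rewrite /g' mulrBr. apply: (idealB idC); last first.
  exact: (idealM idC).
by rewrite -scalerAr -mul_polyC; apply: (idealM idC).
Qed.

End CoefIdeal.

(** * Linearly independent families modulo an ideal *)

Section FamilyDefs.
Variables (K : fieldType) (A : comNzRingType) (iota : K -> A).
Implicit Types (B I : A -> Prop).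

Definition independent I (J : finType) (b : J -> A) :=
  forall c : J -> K, I (\sum_j iota (c j) * b j) -> forall j, c j = 0.

Definition has_family B I n := exists (J : finType) (b : J -> A),
  [/\ #|J| = n, forall j, B (b j) & independent I b].

Definition spanned B n :=
  exists g : 'I_n -> A, forall a, B a ->
    exists c : 'I_n -> K, a = \sum_i iota (c i) * g i.

End FamilyDefs.

Section Families.
Variables (K : fieldType) (A : comNzRingType) (iota : {rmorphism K -> A}).
Implicit Types (B I : A -> Prop).

Lemma family_le_span B n m :
  has_family iota B (fun a => a = 0) n -> spanned iota B m -> (n <= m)%N.
Proof.
move=> [J [b [<- Bb indb]]] [g spang]; rewrite leqNgt; apply/negP => lt_m.
have /fin_all_exists [c bE] (j : 'I_#|J|) : exists cj : 'I_m -> K,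
    b (enum_val j) = \sum_i iota (cj i) * g i by apply: spang.
pose C := \matrix_(j < #|J|, i < m) c j i.
have : kermx C != 0.
  rewrite kermx_eq0 /row_free neq_ltn; apply/orP; left.
  exact: leq_ltn_trans (rank_leq_col C) lt_m.
case/rowV0Pn => u /sub_kermxP uC0 /negP; apply; apply/eqP/rowP => j.
rewrite mxE -(enum_valK j).
apply: (indb (fun k => u 0 (enum_rank k))) (enum_val j).
rewrite (reindex (@enum_val J J)) /=; last first.
  by apply: onW_bij; exact: enum_val_bij.
under eq_bigr => k _ do rewrite enum_valK bE mulr_sumr.
rewrite exchange_big /= big1 // => i _.
under eq_bigr => k _ do rewrite mulrA -rmorphM.
rewrite -mulr_suml -rmorph_sum.
have := congr1 (fun M : 'rV_m => M 0 i) uC0; rewrite !mxE.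
under eq_bigr => k _ do rewrite mxE.
by move=> ->; rewrite rmorph0 mul0r.
Qed.

(** If f is regular modulo I, then multiplication by f carries independent
families modulo I to independent families, and these stay independent of any
family which is independent modulo a larger ideal that contains f. *)
Lemma family_add B B0 I I' f n n' :
    is_ideal I' -> is_ideal I -> (forall a, I a -> I' a) -> I' f ->
    (forall a, I (f * a) -> I a) -> (forall a, B0 a -> B (f * a)) ->
  has_family iota B I' n' -> has_family iota B0 I n -> has_family iota B I (n' + n).
Proof.
move=> idI' idI sub I'f regf Bf [J' [b' [<- Bb' indb']]] [J [b [<- Bb indb]]].
pose d (x : J' + J) := match x with inl j => b' j | inr j => f * b j end.
exists (J' + J)%type, d; split; first by rewrite card_sum.
  by case=> [j|j] /=; [apply: Bb' | apply: Bf].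
move=> c Ic.
have {}Ic : I (\sum_j iota (c (inl j)) * b' j
               + f * \sum_j iota (c (inr j)) * b j).
  have -> : f * \sum_j iota (c (inr j)) * b j =
      \sum_j iota (c (inr j)) * (f * b j).
    by rewrite mulr_sumr; apply: eq_bigr => j _; rewrite mulrCA.
  by move: Ic; rewrite big_sumType.
have c'0 : forall j, c (inl j) = 0.
  apply: (indb' (fun j => c (inl j))).
  rewrite -[X in I' X](addrK (f * \sum_j iota (c (inr j)) * b j)).
  apply: (idealB idI'); first by apply: sub.
  by rewrite mulrC; apply: (idealM idI').
move: Ic; rewrite big1 ?add0r; last by move=> j _; rewrite c'0 rmorph0 mul0r.
by move=> /regf /(indb (fun j => c (inr j))) c0; case.
Qed.

(** The family consists of the products f ^ i * b with b from a family modulo I'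
of filtration index j - i. The element f is allowed to be used any number of
times because only an upper bound on the growth in j is sought in the end, and
Pascal's rule counts these products. *)
Lemma family_chain (B : nat -> A -> Prop) I I' f q r :
    is_ideal I' -> is_ideal I -> (forall a, I a -> I' a) -> I' f ->
    (forall a, I (f * a) -> I a) -> (forall j a, B j a -> B j.+1 (f * a)) ->
    (forall j, has_family iota (B j) I' (q * 'C(j + r, r))) ->
  forall j, has_family iota (B j) I (q * 'C(j + r.+1, r.+1)).
Proof.
move=> idI' idI sub I'f regf Bf fam; elim=> [|j IHj].
  have := fam 0; rewrite !add0n !binn => -[J [b [cJ Bb indb]]].
  by exists J, b; split=> // c Ic; apply: indb; apply: sub.
have -> : 'C(j.+1 + r.+1, r.+1) = ('C(j.+1 + r, r) + 'C(j + r.+1, r.+1))%N.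
  by rewrite addnS binS addSnnS addnC.
rewrite mulnDr.
exact: (family_add idI' idI sub I'f regf (Bf j) (fam j.+1) IHj).
Qed.

End Families.

Section PolyBox.
Variables (K : fieldType) (A : comNzRingType) (iota : {rmorphism K -> A}).
Implicit Types (B : A -> Prop).

Definition poly_box B d (p : {poly A}) := (size p <= d)%N /\ forall i, B p`_i.

Record additive_pred (V : nmodType) (B : V -> Prop) : Prop := AdditivePred {
  pred_0 : B 0;
  pred_D : forall a b, B a -> B b -> B (a + b) }.

Lemma poly_box_additive B d : additive_pred B -> additive_pred (poly_box B d).
Proof.
move=> [B0 BD]; split.
  by split=> [|i]; rewrite ?size_poly0 ?coef0.
move=> p q [szp Bp] [szq Bq]; split=> [|i]; last by rewrite coefD; apply: BD.
by apply: leq_trans (size_polyD _ _) _; rewrite geq_max szp.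
Qed.

Lemma poly_boxM B B' B'' d e p q :
    additive_pred B'' -> (forall a b, B a -> B' b -> B'' (a * b)) ->
  poly_box B d.+1 p -> poly_box B' e q -> poly_box B'' (d + e) (p * q).
Proof.
move=> [B0 BD] BM [szp Bp] [szq Bq]; split.
  by apply: leq_trans (size_polyMleq _ _) _; move: szp szq; lia.
by move=> i; rewrite coefM; apply: (big_ind B'') => // j _; apply: BM.
Qed.

Lemma poly_box_spanned B d n :
  spanned iota B n -> spanned (polyC \o iota) (poly_box B d) (d * n).
Proof.
move=> [g spang].
pose idx (x : 'I_d * 'I_n) := cast_ord (mxvec_cast d n) (enum_rank x).
pose xdi (k : 'I_(d * n)) : 'I_d * 'I_n :=
  enum_val (cast_ord (esym (mxvec_cast d n)) k).
have idxK : cancel idx xdi by move=> x; rewrite /xdi cast_ordK enum_rankK.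
have xdiK : cancel xdi idx by move=> x; rewrite /idx enum_valK cast_ordKV.
exists (fun k => (g (xdi k).2)%:P * 'X^((xdi k).1)) => p [szp Bp].
have /fin_all_exists [c pE] (i : 'I_d) : exists ci : 'I_n -> K,
    p`_i = \sum_j iota (ci j) * g j by apply: spang.
exists (fun k => c (xdi k).1 (xdi k).2).
rewrite (reindex idx) /=; last by apply: onW_bij; exists xdi.
under eq_bigr => x _ do rewrite idxK mulrA -polyCM.
rewrite -(pair_bigA _ (fun i j => (iota (c i j) * g j)%:P * 'X^i)) /=.
rewrite -{1}(coefK p) poly_def (big_ord_widen d (fun i => p`_i *: 'X^i)) //.
rewrite big_mkcond; apply: eq_bigr => i _.
rewrite -mulr_suml -rmorph_sum -pE mul_polyC.
by case: ltnP => // ?; rewrite nth_default // scale0r.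
Qed.

(** This serves for the indeterminates T and U that are the coefficients of
generic linear combinations: they occur in none of the other data, so any number
d of their powers may be used. *)
Lemma family_polyX B I d n :
    is_ideal I -> additive_pred B ->
  has_family iota B I n ->
  has_family (polyC \o iota) (poly_box B d) (coef_ideal I) (n * d).
Proof.
move=> idI addB [J [b [<- Bb indb]]].
exists (J * 'I_d)%type, (fun x : J * 'I_d => (b x.1)%:P * 'X^(x.2)); split.
- by rewrite card_prod card_ord.
- move=> [j i] /=; split=> [|k].
    apply: leq_trans (size_polyMleq _ _) _; rewrite size_polyXn addnS /=.
    by apply: leq_trans (leq_add (size_polyC_leq1 _) (leqnn _)) _; rewrite add1n.
  rewrite coefCM coefXn; case: (k == i); first by rewrite mulr1.
  by rewrite mulr0; apply: pred_0.
- move=> c Ic [j i]; apply: (indb (fun j => c (j, i))).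
  have := Ic i; have -> : \sum_x (polyC \o iota) (c x) * ((b x.1)%:P * 'X^(x.2)) =
      \sum_j \sum_i (iota (c (j, i)))%:P * ((b j)%:P * 'X^i).
    by rewrite pair_bigA; apply: eq_bigr => -[].
  rewrite coef_sum.
  congr I; apply: eq_bigr => k _.
  rewrite coef_sum (bigD1 i) //= big1 ?addr0 => [|l neq_li].
    by rewrite !coefCM coefXn eqxx mulr1.
  by rewrite !coefCM coefXn eq_sym (negPf neq_li : (l == i :> nat) = false) !mulr0.
Qed.

End PolyBox.

(** * A Bezout bound by counting monomials *)

Section Growth.

(** This says that f j <= b j^k + O(j^(k-1)). *)
Definition growth (f : nat -> nat) b k :=
  exists c, forall j, (f j * j <= (b * j + c) * j ^ k)%N.

Lemma growthM f g b b' k l :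
  growth f b k -> growth g b' l -> growth (fun j => f j * g j)%N (b * b') (k + l).
Proof.
move=> [c fc] [c' gc']; exists (b * c' + c * b' + c * c')%N => -[|j].
  by rewrite muln0.
have := leq_mul (fc j.+1) (gc' j.+1); rewrite -(leq_pmul2r (ltn0Sn j)) => le_fg.
rewrite -(leq_pmul2r (ltn0Sn j)) mulnAC -mulnA.
apply: leq_trans (_ : (f j.+1 * j.+1) * (g j.+1 * j.+1) <= _)%N.
  by rewrite leq_eqVlt; apply/orP; left; apply/eqP; ring.
apply: leq_trans (leq_mul (fc j.+1) (gc' j.+1)) _.
rewrite expnD mulnACA [X in (_ <= X)%N]mulnAC leq_mul2r.
apply/orP; right; move: (j) => i; nia.
Qed.

Lemma growth_linear a d : growth (fun j => d + j * a)%N a 1.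
Proof. by exists d => j; rewrite expn1 leq_mul2r; apply/orP; right; lia. Qed.

Lemma growth_quadratic a d : growth (fun j => d + j ^ 2 + j * a)%N 1 2.
Proof.
exists (d + a)%N => -[|j]; first by rewrite muln0.
have : (0 < j.+1)%N by []; move: j.+1 => i ige; rewrite mul1n !expnS expn0; nia.
Qed.

Lemma growth_le f a b k :
  growth f b k -> (forall j, (a * j ^ k <= f j)%N) -> (a <= b)%N.
Proof.
move=> [c fc] le_af; have := fc c.+1; have := le_af c.+1.
rewrite -(leq_pmul2r (ltn0Sn c)) => /leq_trans le1 /le1.
rewrite mulnAC leq_pmul2r ?expn_gt0 // => le_ab; rewrite leqNgt; apply/negP; nia.
Qed.

Lemma leq_bin_fact j r : (j ^ r <= 'C(j + r, r) * r`!)%N.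
Proof.
rewrite bin_ffact; elim: r => [|r IHr]; first by rewrite expn0 ffactn0.
by rewrite addnS ffactnS expnS /=; apply: leq_mul => //; lia.
Qed.

End Growth.

Section Counting.
Variable K : fieldType.

Local Notation R := {poly {poly {poly K}}}.
Local Notation Q := {poly {poly R}}.

Definition cst : {rmorphism K -> R} := polyC \o (polyC \o polyC).

Definition box d1 d2 d3 : R -> Prop :=
  poly_box (poly_box (poly_box (fun _ : K => True) d1) d2) d3.

Lemma all_additive : additive_pred (fun _ : K => True).
Proof. by []. Qed.

Lemma box_additive d1 d2 d3 : additive_pred (box d1 d2 d3).
Proof. by do 3 apply: poly_box_additive; apply: all_additive. Qed.

Lemma boxM d1 d2 d3 e1 e2 e3 p q :
  box d1.+1 d2.+1 d3.+1 p -> box e1 e2 e3 q ->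
  box (d1 + e1) (d2 + e2) (d3 + e3) (p * q).
Proof.
move=> bp bq; apply: (poly_boxM _ _ bp bq).
  by do 2 apply: poly_box_additive; apply: all_additive.
move=> a b ba bb; apply: (poly_boxM _ _ ba bb).
  by apply: poly_box_additive; apply: all_additive.
by move=> u v bu bv; apply: (poly_boxM _ _ bu bv).
Qed.

Lemma poly_box_le (A : comNzRingType) (B B' : A -> Prop) d d' (p : {poly A}) :
  (forall a, B a -> B' a) -> (d <= d')%N -> poly_box B d p -> poly_box B' d' p.
Proof.
move=> sub le_d [szp Bp]; split=> [|i]; first exact: leq_trans le_d.
exact: sub.
Qed.

Lemma box_le d1 d2 d3 e1 e2 e3 p : (d1 <= e1)%N -> (d2 <= e2)%N -> (d3 <= e3)%N ->
  box d1 d2 d3 p -> box e1 e2 e3 p.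
Proof.
move=> le1 le2 le3; apply: poly_box_le => // a.
by apply: poly_box_le => // b; apply: poly_box_le.
Qed.

Lemma mul_cst (a : K) (p : R) k j i : (cst a * p)`_k`_j`_i = a * p`_k`_j`_i.
Proof. by rewrite /cst /= !coefCM. Qed.

(** The flags tell which of x1, x2, y may occur: the degree bound D * F is zero
when F is false. *)
Definition free_poly (F1 F2 F3 : bool) (p : R) :=
  exists D, box (D * F1).+1 (D * F2).+1 (D * F3).+1 p.

Lemma free_poly1 F1 F2 F3 : free_poly F1 F2 F3 1.
Proof.
exists 0; split=> [|k]; first by rewrite size_poly1.
rewrite coef1; case: (k == 0)%N; last by apply: pred_0; do ?apply: poly_box_additive; apply: all_additive.
split=> [|j]; first by rewrite size_poly1.
rewrite coef1; case: (j == 0)%N; last by apply: pred_0; do ?apply: poly_box_additive; apply: all_additive.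
by split=> //; rewrite size_poly1.
Qed.

Lemma free_polyM F1 F2 F3 p q :
  free_poly F1 F2 F3 p -> free_poly F1 F2 F3 q -> free_poly F1 F2 F3 (p * q).
Proof.
move=> [D bp] [D' bq]; exists (D + D')%N; rewrite !mulnDl -!addnS.
exact: boxM bp bq.
Qed.

(** A chain of ideals from the one given as last argument up to V, in which each
ideal contains an element of bounded degree that is regular modulo the previous
ideal. It need not be generated by this element and the previous ideal, so that
passing to saturations is possible. *)
Inductive regular_chain (A : comNzRingType) (deg V : A -> Prop) :
    nat -> (A -> Prop) -> Prop :=
  | RegularChain0 : is_ideal V -> regular_chain deg V 0 V
  | RegularChainS I I' f r : is_ideal I -> is_ideal I' ->
      (forall a, I a -> I' a) -> I' f -> deg f -> (forall a, I (f * a) -> I a) ->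
      regular_chain deg V r I' -> regular_chain deg V r.+1 I.

Lemma regular_chain_family (A : comNzRingType) (iota : {rmorphism K -> A})
    (deg V : A -> Prop) (B : nat -> A -> Prop) q r I :
    (forall f j a, deg f -> B j a -> B j.+1 (f * a)) ->
    (forall j, has_family iota (B j) V q) ->
    regular_chain deg V r I ->
  forall j, has_family iota (B j) I (q * 'C(j + r, r)).
Proof.
move=> degB famV; elim=> [_ j|{}I I' f {}r idI idI' sub I'f degf regf _ IH].
  by rewrite bin0 muln1.
by apply: (family_chain idI' idI sub I'f regf) IH => j a; apply: degB.
Qed.

(** In a linear relation between the products of the b j with the monomials in
the free variables, the factor of b j is one polynomial in these variables. *)
Lemma family_free F1 F2 F3 d (V : R -> Prop) (J : finType) (b : J -> R) M :
    (forall j, box d d d (b j)) ->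
    (forall q : J -> R, (forall j, free_poly F1 F2 F3 (q j)) ->
       V (\sum_j q j * b j) -> forall j, q j = 0) ->
  let bound (F : bool) := if F then M else 1%N in
  has_family cst (box (d + bound F1) (d + bound F2) (d + bound F3)) V
    (#|J| * (bound F1 * bound F2 * bound F3)).
Proof.
move=> bd indb bound.
have boundF (F : bool) : (bound F <= (M * F).+1)%N.
  by rewrite /bound; case: F; rewrite ?muln1 // leqnSn.
pose T := ('I_(bound F1) * 'I_(bound F2) * 'I_(bound F3))%type.
pose mon (t : T) : R := ('X^(t.1.1))%:P%:P * ('X^(t.1.2))%:P * 'X^(t.2).
have coef_mon t k j i :
    (mon t)`_k`_j`_i = ((k == t.2) && (j == t.1.2) && (i == t.1.1))%:R.
  rewrite /mon -polyCM coefCM coefXn; case: (k == _); last by rewrite mulr0 !coef0.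
  rewrite mulr1 coefCM coefXn; case: (j == _); last by rewrite mulr0 coef0.
  by rewrite mulr1 coefXn.
have box_mon (t : T) : box t.1.1.+1 t.1.2.+1 t.2.+1 (mon t).
  split=> [|k].
    apply/leq_sizeP => k lt_k; apply/polyP => j; apply/polyP => i.
    by rewrite coef_mon gtn_eqF // !coef0.
  split=> [|j].
    apply/leq_sizeP => j lt_j; apply/polyP => i.
    by rewrite coef_mon [j == _]gtn_eqF // andbF coef0.
  split=> //; apply/leq_sizeP => i lt_i.
  by rewrite coef_mon [i == _]gtn_eqF // andbF.
exists (J * T)%type, (fun x : J * T => mon x.2 * b x.1); split.
- by rewrite !card_prod !card_ord.
- case=> j t /=; apply: box_le (boxM (box_mon t) (bd j)); rewrite addnC leq_add2l;
    exact: ltnW.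
move=> c Vc [j0 t0].
pose q j := \sum_(t : T) cst (c (j, t)) * mon t.
have coef_q j (t : T) : (q j)`_t.2`_t.1.2`_t.1.1 = c (j, t).
  rewrite /q !coef_sum (bigD1 t) //= big1 ?addr0 => [|u neq_ut].
    by rewrite mul_cst coef_mon !eqxx mulr1.
  rewrite mul_cst coef_mon.
  case: eqP => [/val_inj e3|]; last by rewrite mulr0.
  case: eqP => [/val_inj e2|]; last by rewrite mulr0.
  case: eqP => [/val_inj e1|]; last by rewrite mulr0.
  by case/eqP: neq_ut; move: e1 e2 e3; case: (u) (t) => -[? ?] ? [[? ?] ?] /= -> -> ->.
rewrite -coef_q; suff -> : q j0 = 0 by rewrite !coef0.
apply: indb j0 => [j|].
  exists M; apply: box_le (boundF F1) (boundF F2) (boundF F3) _.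
  apply: (big_ind (box _ _ _)); first exact: pred_0 (box_additive _ _ _).
    exact: pred_D (box_additive _ _ _).
  move=> t _; have bt : box (bound F1) (bound F2) (bound F3) (mon t).
    exact: box_le (box_mon t).
  case: bt => sz3 b2; split=> [|k].
    by rewrite mul_polyC; apply: leq_trans (size_scale_leq _ _) sz3.
  case: (b2 k) => sz2 b1; rewrite coefCM; split=> [|j'].
    by rewrite mul_polyC; apply: leq_trans (size_scale_leq _ _) sz2.
  case: (b1 j') => sz1 _; rewrite coefCM; split=> //.
  by rewrite mul_polyC; apply: leq_trans (size_scale_leq _ _) sz1.
move: Vc; congr V.
rewrite (eq_bigr (fun x => cst (c (x.1, x.2)) * (mon x.2 * b x.1))) => [|[]//].
rewrite -(pair_bigA _ (fun j t => cst (c (j, t)) * (mon t * b j))) /=.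
apply: eq_bigr => j _; rewrite mulr_suml; apply: eq_bigr => t _.
by rewrite mulrA.
Qed.

Lemma poly_box_ex (A : comNzRingType) (B : nat -> A -> Prop) (p : {poly A}) :
    (forall d e a, (d <= e)%N -> B d a -> B e a) -> (forall d, B d 0) ->
    (forall a, exists d, B d a) ->
  exists d, poly_box (B d) d p.
Proof.
move=> Ble B0 Bex.
have /fin_all_exists [e Be] (i : 'I_(size p)) : exists d, B d p`_i by apply: Bex.
exists (maxn (size p) (\max_i e i)); split=> [|i]; first exact: leq_maxl.
case: (ltnP i (size p)) => [lt_i|le_i]; last by rewrite nth_default.
apply: Ble (Be (Ordinal lt_i)); rewrite leq_max; apply/orP; right.
exact: (leq_bigmax (F := e) (Ordinal lt_i)).
Qed.

Lemma box_ex (J : finType) (b : J -> R) : exists d, forall j, box d d d (b j).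
Proof.
have /fin_all_exists [d bd] j : exists d, box d d d (b j).
  apply: (poly_box_ex (B := fun d => poly_box (poly_box (fun=> True) d) d)).
  - by move=> d e a le_de; apply: poly_box_le => // ?; apply: poly_box_le.
  - by move=> d; apply: pred_0; do ?apply: poly_box_additive; apply: all_additive.
  move=> a; apply: (poly_box_ex (B := fun d => poly_box (fun=> True) d)).
  - by move=> d e ? le_de; apply: poly_box_le.
  - by move=> d; apply: pred_0; do ?apply: poly_box_additive; apply: all_additive.
  by move=> u; exists (size u); split.
exists (\max_j d j)%N => j; have le_d := leq_bigmax (F := d) j.
exact: box_le (bd j).
Qed.

Lemma free_polyP F1 F2 F3 p : free_poly F1 F2 F3 p <->
  [/\ F3 || (size p <= 1)%N, forall k, F2 || (size (p`_k)%R <= 1)%N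
    & forall k j, F1 || (size (p`_k`_j)%R <= 1)%N].
Proof.
split=> [[D [sz3 b2]]|[sz3 sz2 sz1]].
  split=> [|k|k j].
  - by move: sz3; case: (F3); rewrite // muln0.
  - by case: (b2 k); case: (F2); rewrite // muln0.
  - by case: (b2 k) => _ /(_ j) []; case: (F1); rewrite // muln0.
have [D /(_ tt) [bd3 b2]] := box_ex (fun _ : unit => p); exists D.
split=> [|k]; last split=> [|j]; last split=> //.
- by case: (F3) sz3 => /= sz3; rewrite ?muln1 ?muln0 // leqW.
- by case: (b2 k) => ? _; case: (F2) (sz2 k) => /= ?; rewrite ?muln1 ?muln0 // leqW.
- case: (b2 k) => _ /(_ j) [? _].
  by case: (F1) (sz1 k j) => /= ?; rewrite ?muln1 ?muln0 // leqW.
Qed.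

Lemma free_poly_sub (F1 F2 F3 G1 G2 G3 : bool) (p : R) :
  (F1 -> G1) -> (F2 -> G2) -> (F3 -> G3) ->
  free_poly F1 F2 F3 p -> free_poly G1 G2 G3 p.
Proof.
move=> sub1 sub2 sub3 /free_polyP [sz3 sz2 sz1]; apply/free_polyP; split=> [|k|k j].
- by apply/orP; case/orP: sz3 => [/sub3|]; [left | right].
- by apply/orP; case/orP: (sz2 k) => [/sub2|]; [left | right].
- by apply/orP; case/orP: (sz1 k j) => [/sub1|]; [left | right].
Qed.

(** The products of the base family with the monomials in the free variables,
with the powers of the two indeterminates T and U and with the products of powers
of the elements of the chain are linearly independent. Using exponents of sum at
most j for the elements of the chain and below j^2 for the other variables, the
number of these products is at most the number of monomials of the same degrees; the
leading terms of both sides in j give the bound, r! being the denominator of the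
binomial coefficient that counts the exponents of the chain. *)
Theorem bezout_bound F1 F2 F3 K1 K2 K3 n (V : R -> Prop) (J : finType) (b : J -> R) :
    is_ideal V ->
    (forall q : J -> R, (forall j, free_poly F1 F2 F3 (q j)) ->
       V (\sum_j q j * b j) -> forall j, q j = 0) ->
    regular_chain (poly_box (poly_box (box K1.+1 K2.+1 K3.+1) n.+1) n.+1 : Q -> Prop)
      (coef_ideal (coef_ideal V)) (~~ F1 + ~~ F2 + ~~ F3) (fun a : Q => a = 0) ->
  (#|J| <= (~~ F1 + ~~ F2 + ~~ F3)`! *
     ((if F1 then 1 else K1) * (if F2 then 1 else K2) * (if F3 then 1 else K3)))%N.
Proof.
move=> idV indb chain; have [d bd] := box_ex b; set r := (_ + ~~ F3)%N in chain *.
pose M F j := if F then (j ^ 2)%N else 1%N.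
pose D (F : bool) a j := (d + M F j + j * a)%N.
pose E j := (0 + j ^ 2 + j * n)%N.
have count j : (#|J| * (M F1 j * M F2 j * M F3 j) * (j ^ 2) * (j ^ 2) * 'C(j + r, r)
    <= E j * (E j * (D F3 K3 j * (D F2 K2 j * (D F1 K1 j * 1)))))%N.
  have spanQ : spanned (polyC \o (polyC \o cst))
      (poly_box (poly_box (box (D F1 K1 j) (D F2 K2 j) (D F3 K3 j)) (E j)) (E j))
      (E j * (E j * (D F3 K3 j * (D F2 K2 j * (D F1 K1 j * 1))))).
    do 2 apply: poly_box_spanned; rewrite /cst; do 2 apply: poly_box_spanned.
    apply: (poly_box_spanned (iota := idfun)).
    by exists (fun=> 1) => a _; exists (fun=> a); rewrite big_ord1 mulr1.
  apply: family_le_span spanQ.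
  pose B i := poly_box (poly_box (box (d + M F1 j + i * K1) (d + M F2 j + i * K2)
    (d + M F3 j + i * K3)) (0 + j ^ 2 + i * n)) (0 + j ^ 2 + i * n).
  apply: (regular_chain_family (B := B) _ _ chain) => [f i a degf Ba|i].
    have step x y : (x + i.+1 * y = y + (x + i * y))%N by rewrite mulSn addnCA.
    rewrite /B !step; apply: (poly_boxM _ _ degf Ba).
      by do ?apply: poly_box_additive; apply: all_additive.
    move=> u v du dv; apply: (poly_boxM _ _ du dv); last by move=> ? ?; apply: boxM.
    by do ?apply: poly_box_additive; apply: all_additive.
  have [T [g [cardT gB indg]]] := family_polyX (j ^ 2) (coef_idealP idV)
    (poly_box_additive (j ^ 2) (box_additive _ _ _))
    (family_polyX (j ^ 2) idV (box_additive _ _ _)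
      (family_free (j ^ 2) bd indb)).
  exists T, g; split=> // t; rewrite /B.
  apply: poly_box_le (gB t) => [a|]; last by rewrite add0n leq_addr.
  apply: poly_box_le => [a'|]; last by rewrite add0n leq_addr.
  by apply: box_le; rewrite leq_addr.
pose c (F : bool) a := if F then 1%N else a; pose e (F : bool) := if F then 2 else 1%N.
have growD F a : growth (D F a) (c F a) (e F).
  by rewrite /D /M; case: F; [apply: growth_quadratic | apply: growth_linear].
have growE : growth E 1 2 by apply: growth_quadratic.
have grow_cst a : growth (fun=> a) a 0 by exists 0 => j; rewrite addn0 muln1.
have grow := growthM (grow_cst r`!) (growthM growE (growthM growE (growthM (growD F3 K3)
  (growthM (growD F2 K2) (growthM (growD F1 K1) (grow_cst 1)))))).
have := growth_le (a := #|J|) grow.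
rewrite !mul1n muln1 -/(c F1 K1) -/(c F2 K2) -/(c F3 K3).
rewrite [(c F1 K1 * _ * _)%N]mulnC [(c F1 K1 * _)%N]mulnC; apply=> j.
rewrite -[X in (_ <= X)%N]mulnC; apply: leq_trans (leq_mul (count j) (leqnn r`!)).
rewrite -!mulnA leq_mul2l; apply/orP; right.
have -> : (j ^ (0 + (2 + (2 + (e F3 + (e F2 + (e F1 + 0)))))) =
    M F1 j * (M F2 j * (M F3 j * (j ^ 2 * (j ^ 2 * j ^ r)))))%N.
  by rewrite /M /r; case: (F1); case: (F2); case: (F3); rewrite -?expnD ?mul1n -?expnD.
do 3! [rewrite leq_mul2l; apply/orP; right]; rewrite -!mulnn -!mulnA.
by do 4! [rewrite leq_mul2l; apply/orP; right]; apply: leq_bin_fact.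
Qed.

End Counting.

(** * Translations acting on polynomials *)

Section Shift.
Variable D : idomainType.
Implicit Types (p : {poly D}) (c : D).

Lemma size_shift p c : size (p \Po ('X + c%:P)) = size p.
Proof. by rewrite size_comp_poly2 // size_XaddC. Qed.

Lemma lead_coef_shift p c : lead_coef (p \Po ('X + c%:P)) = lead_coef p.
Proof.
by rewrite lead_coef_comp ?size_XaddC // lead_coefXaddC expr1n mulr1.
Qed.

Lemma coef_expXaddC c i n : (('X + c%:P) ^+ i)`_n = c ^+ (i - n) *+ 'C(i, n).
Proof.
rewrite addrC exprDn coef_sum; case: (leqP n i) => [le_ni|lt_in].
  rewrite (bigD1 (Ordinal (le_ni : n < i.+1)%N)) //= big1 ?addr0 => [|j neq_jn].
    by rewrite coefMn -rmorphXn coefCM coefXn eqxx mulr1.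
  rewrite coefMn -rmorphXn coefCM coefXn.
  by rewrite eq_sym (negPf neq_jn : (j == n :> nat) = false) mulr0 mul0rn.
rewrite bin_small // mulr0n big1 // => j _.
rewrite coefMn -rmorphXn coefCM coefXn gtn_eqF ?mulr0 ?mul0rn //.
exact: leq_trans (ltn_ord j) lt_in.
Qed.

Lemma coef_shift_subtop p c n : size p = n.+2 ->
  (p \Po ('X + c%:P))`_n = p`_n + p`_n.+1 * c *+ n.+1.
Proof.
move=> szp; rewrite coef_comp_poly szp !big_ord_recr /= big1 ?add0r => [|i _].
  by rewrite !coef_expXaddC subnn expr0 binn mulr1 subSnn expr1 binSn mulrnAr.
by rewrite coef_expXaddC bin_small ?mulr0n ?mulr0.
Qed.

End Shift.

Section Translations.
Variable K : fieldType.
Local Notation R := {poly {poly {poly K}}}.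
Local Notation cst := (@cst K).

Definition x1 : R := 'X%:P%:P.
Definition x2 : R := 'X%:P.
Definition y : R := 'X.

Lemma hom_ext (S : comNzRingType) (phi psi : {rmorphism R -> S}) :
    (forall c, phi (cst c) = psi (cst c)) ->
    phi x1 = psi x1 -> phi x2 = psi x2 -> phi y = psi y ->
  phi =1 psi.
Proof.
move=> ec e1 e2 e3 p.
have eqX (A : comNzRingType) (f g : {rmorphism {poly A} -> S}) :
    (forall a, f a%:P = g a%:P) -> f 'X = g 'X -> f =1 g.
  move=> eC eX q; rewrite -(coefK q) poly_def !rmorph_sum; apply: eq_bigr => i _.
  by rewrite -mul_polyC !rmorphM !rmorphXn /= eC eX.
apply: (eqX _ phi psi) => [q|]; last exact: e3.
apply: (eqX _ (phi \o polyC) (psi \o polyC)) => [a|]; last exact: e2.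
apply: (eqX _ (phi \o (polyC \o polyC)) (psi \o (polyC \o polyC))) => [c|].
  exact: ec.
exact: e1.
Qed.

Lemma hom_ext_comp (S : comNzRingType) (phi psi : {rmorphism R -> S})
    (chi : {rmorphism R -> R}) :
    (forall c, phi (chi (cst c)) = psi (cst c)) ->
    phi (chi x1) = psi x1 -> phi (chi x2) = psi x2 -> phi (chi y) = psi y ->
  forall p, phi (chi p) = psi p.
Proof. exact: (hom_ext (phi := phi \o chi)). Qed.

Definition shift1 (v1 : K) : {rmorphism {poly K} -> {poly K}} :=
  comp_poly ('X + v1%:P).

Definition shift2 (v1 v2 : K) : {rmorphism {poly {poly K}} -> {poly {poly K}}} :=
  comp_poly ('X + v2%:P%:P) \o map_poly (shift1 v1).

(** The polynomial function x |-> p (x + g). *)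
Definition trans (g : grpG K) : {rmorphism R -> R} :=
  comp_poly ((coordY g)%:P%:P *: 'X) \o map_poly (shift2 (coordX1 g) (coordX2 g)).

Definition evalR (g : grpG K) : {rmorphism R -> K} :=
  horner_eval (coordX1 g) \o (horner_eval (coordX2 g)%:P
    \o horner_eval (coordY g)%:P%:P).

Lemma trans_cst g c : trans g (cst c) = cst c.
Proof. by do 3! rewrite /= !(map_polyC, comp_polyC). Qed.

Lemma trans_x1 g : trans g x1 = x1 + cst (coordX1 g).
Proof.
rewrite /= /x1; do 2! rewrite /= !(map_polyC, comp_polyC).
by rewrite /= comp_polyX !rmorphD.
Qed.

Lemma trans_x2 g : trans g x2 = x2 + cst (coordX2 g).
Proof.
by rewrite /= /x2 map_polyC comp_polyC /= map_polyX comp_polyX !rmorphD.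
Qed.

Lemma trans_y g : trans g y = cst (coordY g) * y.
Proof. by rewrite /= /y map_polyX comp_polyX mul_polyC. Qed.

Lemma trans_comp g h p : trans g (trans h p) = trans (g + h) p.
Proof.
have [e1 e2 e3] := coordD g h.
apply: (hom_ext_comp (phi := trans g) (chi := trans h) (psi := trans (g + h))) => [c|||].
- by rewrite !trans_cst.
- by rewrite !trans_x1 e1 (rmorphD (trans g)) trans_x1 trans_cst -addrA -(rmorphD cst).
- by rewrite !trans_x2 e2 (rmorphD (trans g)) trans_x2 trans_cst -addrA -(rmorphD cst).
- rewrite !trans_y e3 (rmorphM (trans g)) trans_y trans_cst.
  by rewrite mulrA (mulrC (cst (coordY h))) -(rmorphM cst).
Qed.

Lemma evalR_cst g c : evalR g (cst c) = c.
Proof. by rewrite /= /horner_eval !hornerC. Qed.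

Lemma evalR_x1 g : evalR g x1 = coordX1 g.
Proof. by rewrite /= /horner_eval !hornerC hornerX. Qed.

Lemma evalR_x2 g : evalR g x2 = coordX2 g.
Proof. by rewrite /= /horner_eval !(hornerC, hornerX). Qed.

Lemma evalR_y g : evalR g y = coordY g.
Proof. by rewrite /= /horner_eval !(hornerC, hornerX). Qed.

Lemma evalR_trans g h p : evalR g (trans h p) = evalR (g + h) p.
Proof.
have [e1 e2 e3] := coordD g h.
apply: (hom_ext_comp (phi := evalR g) (chi := trans h) (psi := evalR (g + h))) => [c|||].
- by rewrite trans_cst !evalR_cst.
- by rewrite trans_x1 (rmorphD (evalR g)) evalR_cst !evalR_x1.
- by rewrite trans_x2 (rmorphD (evalR g)) evalR_cst !evalR_x2.
- by rewrite trans_y (rmorphM (evalR g)) evalR_cst !evalR_y mulrC.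
Qed.

Lemma coef_trans g p k :
  (trans g p)`_k = (coordY g ^+ k)%:P%:P * shift2 (coordX1 g) (coordX2 g) p`_k.
Proof.
rewrite -[trans g p]/(map_poly _ p \Po _); set q := map_poly _ p.
have -> : (q \Po ((coordY g)%:P%:P *: 'X))`_k = (coordY g)%:P%:P ^+ k * q`_k.
  rewrite coef_comp_poly; case: (ltnP k (size q)) => [lt_k|le_k]; last first.
    rewrite [in RHS]nth_default // mulr0 big1 // => i _.
    by rewrite exprZn coefZ coefXn gtn_eqF ?mulr0 //; apply: leq_trans le_k.
  rewrite (bigD1 (Ordinal lt_k)) //= big1 ?addr0 => [|i neq_ik].
    by rewrite exprZn coefZ coefXn eqxx mulr1 mulrC.
  rewrite exprZn coefZ coefXn.
  by rewrite eq_sym (negPf neq_ik : (i == k :> nat) = false) !mulr0.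
by rewrite /q coef_map !rmorphXn.
Qed.

Lemma size_shift1 v1 b : size (shift1 v1 b) = size b.
Proof. exact: size_shift. Qed.

Lemma lead_coef_shift1 v1 b : lead_coef (shift1 v1 b) = lead_coef b.
Proof. exact: lead_coef_shift. Qed.

Lemma shift1_inj v1 : injective (shift1 v1).
Proof.
move=> b c eq_bc; apply/eqP; rewrite -subr_eq0 -size_poly_eq0 -(size_shift1 v1).
by rewrite rmorphB eq_bc subrr size_poly0.
Qed.

Lemma size_shift2 v1 v2 b : size (shift2 v1 v2 b) = size b.
Proof.
rewrite -[shift2 v1 v2 b]/(map_poly _ b \Po _) size_shift.
by rewrite size_map_inj_poly //; [apply: shift1_inj | rewrite rmorph0].
Qed.

Lemma lead_coef_shift2 v1 v2 b :
  lead_coef (shift2 v1 v2 b) = shift1 v1 (lead_coef b).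
Proof.
rewrite -[shift2 v1 v2 b]/(map_poly _ b \Po _) lead_coef_shift.
by rewrite lead_coef_map_inj //; [apply: shift1_inj | rewrite rmorph0].
Qed.

Lemma coordY_neq0 (g : grpG K) : coordY g != 0.
Proof. exact: valP g.2. Qed.

Lemma coef_trans_eq0 g p k : ((trans g p)`_k == 0) = (p`_k == 0).
Proof.
rewrite coef_trans mulf_eq0 !polyC_eq0 expf_eq0 (negPf (coordY_neq0 g)) andbF /=.
by rewrite -!size_poly_eq0 size_shift2.
Qed.

Lemma size_trans g p : size (trans g p) = size p.
Proof.
apply/eqP; rewrite eqn_leq; apply/andP; split; apply/leq_sizeP => k le_k; apply/eqP.
  by rewrite coef_trans_eq0 nth_default.
by rewrite -(coef_trans_eq0 g) nth_default.
Qed.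

Lemma trans_box g d1 d2 d3 p : box d1 d2 d3 p -> box d1 d2 d3 (trans g p).
Proof.
move=> [sz3 b2]; split=> [|k]; first by rewrite size_trans.
case: (b2 k) => sz2 b1; rewrite coef_trans.
have szt : size (shift2 (coordX1 g) (coordX2 g) p`_k) = size p`_k by apply: size_shift2.
split=> [|j].
  by rewrite mul_polyC; apply: leq_trans (size_scale_leq _ _) _; rewrite szt.
split=> //; rewrite coefCM mul_polyC; apply: leq_trans (size_scale_leq _ _) _.
rewrite -[shift2 _ _ _]/(map_poly _ _ \Po _) coef_comp_poly.
apply: leq_trans (size_sum _ _ _) _; apply/bigmax_leqP => i _.
rewrite coef_expXaddC -rmorphXn -rmorphMn mulrC mul_polyC coef_map.
apply: leq_trans (size_scale_leq _ _) _; rewrite size_shift1.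
by case: (b1 i).
Qed.

End Translations.

(** * Polynomials in three variables as iterated polynomials *)

Section Embedding.
Variable K : fieldType.
Local Notation R := {poly {poly {poly K}}}.
Local Notation i0 := (inord 0 : 'I_3).
Local Notation i1 := (inord 1 : 'I_3).
Local Notation i2 := (inord 2 : 'I_3).

Definition of_mpoly (p : {mpoly K[3]}) : R :=
  \sum_(m <- msupp p)
    cst _ p@_m * (('X^(m i0))%:P%:P * ('X^(m i1))%:P * 'X^(m i2)).

Lemma coef_of_mpoly_term (c : K) a b d k j i :
  (cst _ c * (('X^a)%:P%:P * ('X^b)%:P * 'X^d) : R)`_k`_j`_i
    = c * ((k == d) && (j == b) && (i == a))%:R.
Proof.
rewrite mul_cst -polyCM coefCM coefXn; case: (k == _); last by rewrite mulr0 !coef0.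
rewrite mulr1 coefCM coefXn; case: (j == _); last by rewrite mulr0 coef0.
by rewrite mulr1 coefXn.
Qed.

Lemma ord3_all (Q : 'I_3 -> Prop) : Q i0 -> Q i1 -> Q i2 -> forall i, Q i.
Proof.
move=> Q0 Q1 Q2 i; case: i => -[|[|[|//]]] lt_i.
- by have -> : Ordinal lt_i = i0 by apply: val_inj; rewrite /= inordK.
- by have -> : Ordinal lt_i = i1 by apply: val_inj; rewrite /= inordK.
- by have -> : Ordinal lt_i = i2 by apply: val_inj; rewrite /= inordK.
Qed.

Lemma of_mpoly_neq0 p : p != 0 -> of_mpoly p != 0.
Proof.
move=> p0; set m := mlead p; have supp_m : m \in msupp p by apply: mlead_supp.
apply: contra_neq (_ : p@_m != 0); last by rewrite -mcoeff_msupp.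
move=> /(congr1 (fun q : R => q`_(m i2)`_(m i1)`_(m i0))).
rewrite !coef0 => <-; rewrite /of_mpoly !coef_sum (bigD1_seq m) ?msupp_uniq //=.
rewrite coef_of_mpoly_term !eqxx mulr1 big1 ?addr0 // => m' neq_m'.
rewrite coef_of_mpoly_term; case: eqP => [e2|]; last by rewrite mulr0.
case: eqP => [e1|]; last by rewrite mulr0.
case: eqP => [e0|]; last by rewrite mulr0.
by case/eqP: neq_m'; apply/mnmP; apply: ord3_all.
Qed.

Lemma of_mpoly_box K1 K2 L p :
    (pdeg i0 p <= K1)%N -> (pdeg i1 p <= K2)%N -> (pdeg i2 p <= L)%N ->
  box K1.+1 K2.+1 L.+1 (of_mpoly p).
Proof.
move=> d0 d1 d2; rewrite /of_mpoly big_seq.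
apply: (big_ind (box _ _ _)) => [||m supp_m].
- exact: pred_0 (box_additive _ _ _ _).
- exact: pred_D (box_additive _ _ _ _).
have le_d i : (m i <= pdeg i p)%N.
  exact: (leq_bigmax_seq (F := fun m : 'X_{1..3} => m i)).
have {}d0 := leq_trans (le_d i0) d0; have {}d1 := leq_trans (le_d i1) d1.
have {}d2 := leq_trans (le_d i2) d2.
split=> [|k].
  apply/leq_sizeP => k lt_k; apply/polyP => j; apply/polyP => i.
  rewrite coef_of_mpoly_term gtn_eqF ?mulr0 ?coef0 //.
  exact: leq_ltn_trans lt_k.
split=> [|j].
  apply/leq_sizeP => j lt_j; apply/polyP => i.
  rewrite coef_of_mpoly_term [j == _]gtn_eqF ?andbF ?mulr0 ?coef0 //.
  exact: leq_ltn_trans lt_j.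
split=> //; apply/leq_sizeP => i lt_i.
rewrite coef_of_mpoly_term [i == _]gtn_eqF ?andbF ?mulr0 //.
exact: leq_ltn_trans lt_i.
Qed.

Lemma evalR_of_mpoly g p : evalR g (of_mpoly p) = p.@[coords g].
Proof.
rewrite mevalE (rmorph_sum (evalR g)); apply: eq_bigr => m _.
rewrite !(rmorphM (evalR g)) evalR_cst; congr (_ * _).
have -> : ('X^(m i0))%:P%:P = x1 K ^+ m i0 by rewrite /x1 !rmorphXn.
have -> : ('X^(m i1))%:P = x2 K ^+ m i1 by rewrite /x2 !rmorphXn.
rewrite -/(y K) !(rmorphXn (evalR g)) evalR_x1 evalR_x2 evalR_y.
rewrite !big_ord_recl big_ord0 mulr1 mulrA.
have e0 : ord0 = i0 by apply: val_inj; rewrite /= inordK.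
have e1 : lift ord0 ord0 = i1 by apply: val_inj; rewrite /= inordK.
have e2 : lift ord0 (lift ord0 ord0) = i2 by apply: val_inj; rewrite /= inordK.
by rewrite e2 e1 e0 /coords !(tnth_nth 0) /= !inordK.
Qed.

End Embedding.

(** * Stabilizers of subspaces of polynomials *)

Lemma ex_minimal (T : Type) (mu : T -> nat) (Q : T -> Prop) :
  (exists x, Q x) -> exists x, Q x /\ forall z, Q z -> (mu x <= mu z)%N.
Proof.
move=> [x]; elim: {x}(mu x) {-2}x (leqnn (mu x)) => [|n IHn] x le_x Qx.
  by exists x; split=> // z _; apply: leq_trans le_x _.
case: (boolp.EM (exists z, Q z /\ (mu z <= n)%N)) => [[z [Qz /IHn]]|noz].
  exact.
exists x; split=> // z Qz; apply: leq_trans le_x _; rewrite ltnNge; apply/negP => le_z.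
by apply: noz; exists z.
Qed.

Section Stabilizers.
Variable K : fieldType.
Hypothesis charK0 : [pchar K] =i pred0.
Local Notation R := {poly {poly {poly K}}}.
Implicit Types (Q : R -> Prop) (g : grpG K).

Lemma natr_neq0 n : n.+1%:R != 0 :> K.
Proof. by move/pcharf0P: charK0 => ->. Qed.

Definition stab Q g := forall p, Q p -> Q (trans g p).

Record is_subspace Q : Prop := IsSubspace {
  subspaceB : forall p q, Q p -> Q q -> Q (p - q);
  subspaceZ : forall c p, Q p -> Q (cst K c * p) }.

Lemma ideal_subspace Q : is_ideal Q -> is_subspace Q.
Proof. by move=> idQ; split=> *; [apply: (idealB idQ)|apply: (idealM idQ)]. Qed.

(** In a subspace, an element whose leading term for the order y > x2 > x1 is
minimal is an eigenvector of every translation that preserves the subspace,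
because such a translation multiplies the leading term by a constant. *)
Lemma ex_eigenvector Q :
    is_subspace Q -> (exists p, Q p /\ p != 0) ->
  exists h, [/\ Q h, h != 0, forall p, Q p -> p != 0 -> (size h <= size p)%N &
    forall g, stab Q g -> forall k, h`_k != 0 ->
      coordY g ^+ k = coordY g ^+ (size h).-1
      /\ shift2 (coordX1 g) (coordX2 g) h`_k = h`_k].
Proof.
move=> subQ exQ.
have [h0 [Qh0 min0]] := ex_minimal (fun p : R => size p) exQ.
pose Q1 p := [/\ Q p, p != 0 & size p = size h0].
have [|h1 [Qh1 min1]] := @ex_minimal _ (fun p : R => size (lead_coef p)) Q1.
  by exists h0; case: Qh0.
pose Q2 p := Q1 p /\ size (lead_coef p) = size (lead_coef h1).
have [|h [Qh min2]] := @ex_minimal _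
  (fun p : R => size (lead_coef (lead_coef p))) Q2; first by exists h1.
have [[Qh' h_neq0 szh] szlh] := Qh.
exists h; split=> // [p Qp p0|g stabg k hk0]; first by rewrite szh; apply: min0.
set j := (size h).-1; set t := coordY g.
have eig : trans g h = cst K (t ^+ j) * h.
  apply/eqP; rewrite -subr_eq0; apply: contraTT isT => d0; set d := _ - _ in d0.
  have Qd : Q d by apply: (subspaceB subQ); [apply: stabg|apply: (subspaceZ subQ)].
  have szd : (size d <= size h)%N.
    apply: leq_trans (size_polyD _ _) _; rewrite size_polyN geq_max size_trans leqnn /=.
    by rewrite mul_polyC; apply: size_scale_leq.
  have {}szd : size d = size h0.
    apply/eqP; rewrite eqn_leq -{1}szh szd /=; exact: min0.
  have Q1d : Q1 d by split.
  have ld : lead_coef d = (t ^+ j)%:P%:P * (shift2 (coordX1 g) (coordX2 g) (lead_coef h) - lead_coef h).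
    rewrite /lead_coef szd -szh coefB coef_trans [(cst K _ * _)`_ _]coefCM.
    by rewrite -/j -mulrBr.
  set b := lead_coef h in ld *; have szb : size b = size (lead_coef h1) := szlh.
  have szs : size (shift2 (coordX1 g) (coordX2 g) b) = size b := size_shift2 _ _ _.
  have szld : (size (lead_coef d) <= size b)%N.
    rewrite ld mul_polyC; apply: leq_trans (size_scale_leq _ _) _.
    by apply: leq_trans (size_polyD _ _) _; rewrite size_polyN szs maxnn.
  have {}szld : size (lead_coef d) = size (lead_coef h1).
    by apply/eqP; rewrite eqn_leq -{1}szb szld /=; apply: min1.
  have := min2 d (conj Q1d szld); rewrite -/b leqNgt => /negP [].
  have -> : lead_coef (lead_coef d) =
      (t ^+ j)%:P * (shift1 (coordX1 g) (lead_coef b) - lead_coef b).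
    rewrite [LHS]lead_coefE szld -szb ld coefCM coefB.
    by rewrite -(lead_coef_shift2 _ (coordX2 g)) /lead_coef szs.
  rewrite mul_polyC; apply: leq_ltn_trans (size_scale_leq _ _) _.
  have lb0 : lead_coef b != 0 by rewrite !lead_coef_eq0.
  set c := lead_coef b in lb0 *.
  rewrite -(prednK (_ : 0 < size c)%N) ?size_poly_gt0 // ltnS.
  apply/leq_sizeP => n; rewrite leq_eqVlt => /orP [/eqP <-|lt_n].
    rewrite coefB -{1}(size_shift1 (coordX1 g) c) -/(lead_coef (shift1 _ c)).
    by rewrite lead_coef_shift1 subrr.
  have le_n : (size c <= n)%N by move: lt_n; case: (size c).
  by rewrite coefB !nth_default ?subrr ?size_shift1.
have eigk : (t ^+ k)%:P%:P * shift2 (coordX1 g) (coordX2 g) h`_k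
    = (t ^+ j)%:P%:P * h`_k.
  by rewrite -coef_trans eig /cst /= coefCM.
have tkj : t ^+ k = t ^+ j.
  have := congr1 (fun b => lead_coef (lead_coef b)) eigk.
  rewrite !lead_coefM !lead_coefC lead_coef_shift2 lead_coef_shift1.
  by apply: mulIf; rewrite !lead_coef_eq0.
split=> //; move: eigk; rewrite tkj; apply: mulfI.
by rewrite !polyC_eq0 expf_eq0 (negPf (coordY_neq0 g)) andbF.
Qed.

(** Let c be the leading coefficient of b in x2. It is invariant under the shift
of x1 by v1, so v1 = 0 unless c is constant. If c is constant, the next
coefficient r satisfies r (x1 + v1) - r (x1) = - d c v2 where d is the degree of b
in x2: this is a linear equation if r has degree at most one, and otherwise
v1 = 0. The characteristic matters because degrees appear as factors. *)
Lemma shift2_invariant (b : {poly {poly K}}) :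
    ~ (size b <= 1 /\ size (b`_0)%R <= 1)%N ->
  exists ab : K * K, [/\ ab <> (0, 0),
    forall v1 v2, shift2 v1 v2 b = b -> ab.1 * v1 + ab.2 * v2 = 0,
    (size b <= 1)%N -> ab.2 = 0 &
    (forall j, size (b`_j)%R <= 1)%N -> ab.1 = 0].
Proof.
move=> nonconst; have b0 : b != 0.
  by apply/eqP => b0; apply: nonconst; rewrite b0 coef0 !size_poly0.
have invc (c : {poly K}) v1 n : size c = n.+2 -> c`_n = (shift1 v1 c)`_n -> v1 = 0.
  move=> szc; rewrite coef_shift_subtop // -[LHS]addr0 => /addrI /esym/eqP.
  rewrite -mulr_natr mulf_eq0 (negPf (natr_neq0 n)) orbF mulf_eq0.
  have -> : c`_n.+1 = lead_coef c by rewrite lead_coefE szc.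
  by rewrite lead_coef_eq0 -size_poly_eq0 szc /= => /eqP.
have [szlb|szlb] := ltnP 1 (size (lead_coef b)).
  exists (1, 0); split=> //; first by case=> /eqP; rewrite oner_eq0.
    move=> v1 v2 inv_b; rewrite mul0r addr0 mul1r.
    apply: (invc (lead_coef b) v1 (size (lead_coef b)).-2); first by case: size szlb => [|[]].
    by rewrite -(lead_coef_shift2 v1 v2) inv_b.
  by move=> /(_ (size b).-1); rewrite -lead_coefE leqNgt szlb.
have [n szb] : exists n, size b = n.+2.
  case szb: (size b) (b0) => [|[|n]]; first by rewrite -size_poly_eq0 szb.
    by case: nonconst; rewrite szb; split=> //; move: szlb; rewrite lead_coefE szb.
  by exists n.
set r := b`_n; pose c := (lead_coef b)`_0.
have lbE : lead_coef b = c%:P by apply: size1_polyC.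
have c0 : c != 0 by rewrite -polyC_eq0 -lbE lead_coef_eq0.
have inv_r v1 v2 : shift2 v1 v2 b = b -> shift1 v1 r + (c * v2 *+ n.+1)%:P = r.
  move=> /(congr1 (fun q : {poly {poly K}} => q`_n)).
  rewrite -[shift2 v1 v2 b]/(map_poly _ b \Po _) coef_shift_subtop ?coef_map; last first.
    by rewrite size_map_inj_poly //; [apply: shift1_inj|rewrite rmorph0].
  have -> : b`_n.+1 = c%:P by rewrite -lbE lead_coefE szb.
  move=> inv_n; rewrite -[RHS]inv_n; congr (_ + _).
  rewrite -[X in _ = X * _ *+ _]/(c%:P \Po ('X + v1%:P)) comp_polyC.
  by rewrite -rmorphM -rmorphMn.
case: (leqP (size r) 2) => [szr|szr].
  exists (r`_1, c *+ n.+1); split=> /=.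
  - by case=> _ /eqP; rewrite -mulr_natr mulf_eq0 (negPf c0) (negPf (natr_neq0 n)).
  - move=> v1 v2 /inv_r /(congr1 (horner_eval 0)); rewrite /horner_eval hornerD hornerC.
    rewrite horner_comp !hornerE !(horner_coef_wide _ szr) !big_ord_recr !big_ord0 /=.
    rewrite !expr0 !expr1 !mulr1 mulr0 addr0 !add0r -addrA -[RHS]addr0 => /addrI.
    by rewrite mulrnAl.
  - by rewrite szb.
  - by move=> /(_ n) szrn; rewrite nth_default.
exists (1, 0); split=> //; first by case=> /eqP; rewrite oner_eq0.
  move=> v1 v2 /inv_r inv; rewrite mul0r addr0 mul1r.
  apply: (invc r v1 (size r).-2); first by case: size szr => [|[]].
  have := congr1 (fun q : {poly K} => q`_(size r).-2) inv.
  rewrite coefD coefC; have -> : ((size r).-2 == 0)%N = false.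
    by case: size szr => [|[|[|]]].
  by rewrite addr0.
by move=> /(_ n); rewrite -/r leqNgt (ltnW szr).
Qed.

(** Some coefficient in y of a common eigenvector of the translations that
preserve Q is not constant, and it is invariant under them. *)
Lemma stab_line Q :
    is_subspace Q -> (exists p, Q p /\ p != 0) ->
    (forall p, Q p -> free_poly false false true p -> p = 0) ->
  exists ab : K * K, [/\ ab <> (0, 0),
    forall g, stab Q g -> ab.1 * coordX1 g + ab.2 * coordX2 g = 0,
    (forall p, Q p -> free_poly true false true p) -> ab.2 = 0 &
    (forall p, Q p -> free_poly false true true p) -> ab.1 = 0].
Proof.
move=> subQ exQ noQ; have [h [Qh h0 _ inv_h]] := ex_eigenvector subQ exQ.
have [k nonconst] : exists k, ~ (size (h`_k)%R <= 1 /\ size (h`_k`_0)%R <= 1)%N.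
  apply: boolp.contrapT => allconst; case/eqP: h0; apply: noQ => //.
  have constk k : (size (h`_k)%R <= 1 /\ size (h`_k`_0)%R <= 1)%N.
    by apply: boolp.contrapT => nonk; apply: allconst; exists k.
  apply/free_polyP; split=> // [k|k j]; first by case: (constk k).
  case: (constk k) => szk szk0 /=; case: j => // j.
  by rewrite [h`_k`_j.+1]nth_default ?size_poly0 // (leq_trans szk).
have hk0 : h`_k != 0.
  by apply/eqP => hk0; apply: nonconst; rewrite hk0 coef0 !size_poly0.
have [ab [ab0 line_ab ab2 ab1]] := shift2_invariant nonconst.
exists ab; split=> // [g stabg|Qx1|Qx2].
- by apply: line_ab; case: (inv_h g stabg k hk0).
- by apply: ab2; have /free_polyP [_ /(_ k)] := Qx1 _ Qh.
- by apply: ab1 => j; have /free_polyP [_ _ /(_ k j)] := Qx2 _ Qh.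
Qed.

End Stabilizers.

(** * Unmixedness of ideals with one or two generators *)

Section Divisibility.
Variable A : idomainType.
Implicit Types (u v w s t f : A).

Definition prime_elt u := u != 0 /\
  forall a b, principal u (a * b) -> principal u a \/ principal u b.

Lemma prime_elt_kernel (B : idomainType) (phi : {rmorphism A -> B}) u :
  u != 0 -> (forall a, phi a = 0 <-> principal u a) -> prime_elt u.
Proof.
move=> u0 ker; split=> // a b /ker/eqP.
by rewrite rmorphM mulf_eq0 => /orP [] /eqP /ker; [left | right].
Qed.

(** If u f = a s and w f = b s, then w a = u b, hence u divides a. *)
Lemma principal_unmixed_prime u w s f :
    prime_elt u -> ~ principal u w -> s != 0 ->
  principal s (u * f) -> principal s (w * f) -> principal s f.
Proof.
move=> [u0 pru] nuw s0 [a ufE] [b wfE].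
have wa : a * w = b * u.
  apply: (mulIf s0); transitivity (u * (w * f)); last by rewrite wfE; ring.
  by rewrite mulrCA ufE; ring.
have [||[c aE]] := pru a w; first by exists b.
  move=> [c aE]; exists c; apply: (mulfI u0); rewrite ufE aE; ring.
by case: nuw; exists c.
Qed.

Definition ideal2 s t a := exists p q, a = p * s + q * t.

Lemma ideal2_ideal s t : is_ideal (ideal2 s t).
Proof.
split=> [|_ _ [p [q ->]] [p' [q' ->]]|a _ [p [q ->]]].
- by exists 0, 0; rewrite !mul0r addr0.
- by exists (p + p'), (q + q'); ring.
- by exists (a * p), (a * q); ring.
Qed.

Definition koszul s t :=
  forall p q, p * s + q * t = 0 -> exists g, p = g * t /\ q = - (g * s).

Lemma koszul_sym s t : koszul s t -> koszul t s.
Proof.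
move=> kos p q; rewrite addrC => /kos [g [qE pE]].
by exists (- g); rewrite qE pE; split; ring.
Qed.

Definition regular_mod u v w :=
  forall g h, principal u (w * g - v * h) -> exists g', principal u (g - v * g').

Lemma ideal2_unmixed_aux u v w s t f :
    prime_elt u -> ~ principal u v -> regular_mod u v w -> koszul s t ->
    ~ principal u s ->
    ideal2 s t (u * f) -> ideal2 s t (v * f) -> ideal2 s t (w * f) ->
  ideal2 s t f.
Proof.
move=> [u0 pru] nuv regvw kos nus [a1 [a2 ufE]] [b1 [b2 vfE]] [c1 [c2 wfE]].
(* The syzygies between u f, v f and w f are Koszul syzygies of s and t. *)
have [g [_ gE]] : exists g, v * a1 - u * b1 = g * t /\ v * a2 - u * b2 = - (g * s).
  apply: kos; transitivity (v * (a1 * s + a2 * t) - u * (b1 * s + b2 * t)); first ring.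
  by rewrite -ufE -vfE; ring.
have [h [_ hE]] : exists h, w * a1 - u * c1 = h * t /\ w * a2 - u * c2 = - (h * s).
  apply: kos; transitivity (w * (a1 * s + a2 * t) - u * (c1 * s + c2 * t)); first ring.
  by rewrite -ufE -wfE; ring.
have [g' [d gg']] : exists g', principal u (g - v * g').
  apply: (regvw g h); case: (pru (w * g - v * h) s) => //.
  exists (w * b2 - v * c2).
  have -> : (w * g - v * h) * s = v * - (h * s) - w * - (g * s) by ring.
  by rewrite -gE -hE; ring.
have [|//|[e eE]] := pru v (a2 + g' * s).
  exists (b2 - d * s).
  have -> : v * (a2 + g' * s) = (v * a2 - u * b2) + u * b2 + (v * g') * s by ring.
  rewrite gE; have -> : v * g' = g - d * u by rewrite -gg'; ring.
  ring.
have [||[e' e'E]] := pru (a1 - g' * t) s; last by case: nus; exists e'.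
  exists (f - e * t).
  have -> : (f - e * t) * u = u * f - (e * u) * t by ring.
  by rewrite ufE -eE; ring.
move=> [e' e'E]; exists e', e; apply: (mulfI u0).
rewrite ufE.
have -> : a1 = e' * u + g' * t by rewrite -e'E; ring.
have -> : a2 = e * u - g' * s by rewrite -eE; ring.
ring.
Qed.

(** The associated primes of the ideal of a regular sequence s, t have height
two, whereas u, v, w is a regular sequence of length three. The proof compares
the syzygies of s and t given by u f, v f and w f modulo the prime element u,
which does not divide s, up to exchanging s and t. *)
Lemma ideal2_unmixed u v w s t f :
    prime_elt u -> ~ principal u v -> regular_mod u v w -> koszul s t ->
    s != 0 ->
    ideal2 s t (u * f) -> ideal2 s t (v * f) -> ideal2 s t (w * f) ->
  ideal2 s t f.
Proof.
move=> pru nuv regvw kos s0 Iu Iv Iw.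
case: (boolp.EM (principal u s)) => [us|nus]; last first.
  exact: (ideal2_unmixed_aux pru nuv regvw kos nus Iu Iv Iw).
have sym a : ideal2 s t a -> ideal2 t s a.
  by move=> [p [q ->]]; exists q, p; rewrite addrC.
have [p [q ->]] : ideal2 t s f; last by exists q, p; rewrite addrC.
apply: (ideal2_unmixed_aux pru nuv regvw (koszul_sym kos) _ (sym _ Iu) (sym _ Iv)
  (sym _ Iw)).
case: us => a sE [b tE].
have [g [_ aE]] : exists g, - b = g * t /\ a = - (g * s).
  by apply: kos; rewrite {1}sE {1}tE; ring.
case: nuv; exists (- (v * g)); apply: (mulIf s0).
by transitivity (v * (a * u)); [rewrite -sE | rewrite aE; ring].
Qed.

Lemma koszul_regular s t :
  s != 0 -> (forall a, principal s (t * a) -> principal s a) -> koszul s t.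
Proof.
move=> s0 regt p q /eqP; rewrite addr_eq0 => /eqP psE.
have [|c qE] := regt q; first by exists (- p); rewrite mulNr psE; ring.
exists (- c); split; last by rewrite qE; ring.
by apply: (mulIf s0); rewrite psE qE; ring.
Qed.

End Divisibility.

Section DivisibilityPoly.
Variable A : idomainType.
Implicit Types (u v w : A).

Lemma principal_polyC u (p : {poly A}) :
  principal u%:P p <-> forall i, principal u p`_i.
Proof.
split=> [[q ->] i|divp]; first by rewrite coefMC; exists q`_i.
have /fin_all_exists [c cE] (i : 'I_(size p)) : exists c, p`_i = c * u by apply: divp.
exists (\poly_(i < size p) (if insub i is Some j then c j else 0)).
apply/polyP => i; rewrite coefMC coef_poly; case: ltnP => [lt_i|le_i].
  by rewrite insubT -(cE (Ordinal lt_i)).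
by rewrite mul0r nth_default.
Qed.

Lemma prime_elt_polyC u : prime_elt u -> prime_elt u%:P.
Proof.
move=> [u0 pru]; split=> [|a b /principal_polyC divab]; first by rewrite polyC_eq0.
case: (boolp.EM (principal u%:P a)) => [|nua]; [by left | right].
apply/principal_polyC; apply: (mccoy (principal_ideal u) _ divab) => c divc.
apply: boolp.contrapT => nuc; apply: nua; apply/principal_polyC => i.
by case: (pru c a`_i (divc i)).
Qed.

Lemma regular_mod_polyC u v w : regular_mod u v w -> regular_mod u%:P v%:P w%:P.
Proof.
move=> reg g h /principal_polyC divgh.
have /fin_all_exists [c cE] (i : 'I_(size g)) : exists c, principal u (g`_i - v * c).
  by apply: (reg _ h`_i); have := divgh i; rewrite coefB !coefCM.
exists (\poly_(i < size g) (if insub i is Some j then c j else 0)).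
apply/principal_polyC => i; rewrite coefB coefCM coef_poly.
case: ltnP => [lt_i|le_i]; first by rewrite insubT; apply: (cE (Ordinal lt_i)).
by rewrite mulr0 subr0 nth_default //; apply: ideal0; apply: principal_ideal.
Qed.

(** By induction on the degree of a: the constant p divides the product of the
leading coefficients of q and a, so the leading term of a can be removed after
multiplication by the leading coefficient of q. *)
Lemma principal_lead_coef (C : A -> Prop) (p : A) (q a : {poly A}) :
    (forall b c, C b -> C c -> C (b * c)) -> C (lead_coef q) ->
  principal p%:P (q * a) -> exists2 c, C c & principal p%:P (c%:P * a).
Proof.
move=> CM Cq; have idP := principal_ideal p%:P.
elim: {a}(size a) {-2}a (leqnn (size a)) => [|n IHn] a sza divqa.
  exists (lead_coef q) => //; move: sza; rewrite leqn0 size_poly_eq0 => /eqP ->.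
  by rewrite mulr0; apply: (ideal0 idP).
case: (ltnP (size a) n.+1) => [lt_a|le_a]; first exact: IHn.
have {le_a sza} sza : size a = n.+1 by apply/eqP; rewrite eqn_leq sza.
set l := lead_coef q in Cq *.
have top : principal p (l * lead_coef a).
  by rewrite -lead_coefM lead_coefE; move/principal_polyC: divqa.
have topX : principal p%:P ((l * lead_coef a)%:P * 'X^n).
  by rewrite mulrC; apply: (idealM idP); apply/principal_polyC => i;
    rewrite coefC; case: (i == 0)%N => //; apply: ideal0; apply: principal_ideal.
pose a2 := l%:P * a - (l * lead_coef a)%:P * 'X^n.
have [||c Cc divc] := IHn a2.
- apply/leq_sizeP => k le_nk; rewrite coefB !coefCM coefXn.
  move: le_nk; rewrite leq_eqVlt => /orP [/eqP <-|lt_nk].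
    by rewrite eqxx mulr1 lead_coefE sza subrr.
  by rewrite gtn_eqF // mulr0 subr0 [a`_k]nth_default ?mulr0 // sza.
- by rewrite mulrBr mulrCA; apply: (idealB idP); apply: (idealM idP).
exists (c * l); first exact: CM.
have -> : (c * l)%:P * a = c%:P * a2 + c%:P * ((l * lead_coef a)%:P * 'X^n).
  by rewrite -mulrDr subrK mulrA -polyCM.
by apply: (idealD idP) => //; apply: (idealM idP).
Qed.

End DivisibilityPoly.

Section LinearFactors.
Variables (K : closedFieldType) (A : comNzRingType) (phi : {rmorphism {poly K} -> A}).

Lemma strip_linear_factors (I G : A -> Prop) c f :
    is_ideal I -> (forall a b, G b -> G (a * b)) ->
    (forall z b, G b -> I (phi ('X - z%:P) * b) -> I b) ->
    c != 0 -> G f -> I (phi c * f) -> I f.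
Proof.
move=> idI GM strip c0; have [r cE] := closed_field_poly_normal c.
move: c0; rewrite -lead_coef_eq0 => lc0; set l := lead_coef c in cE lc0.
have {cE} -> : c = l%:P * \prod_(z <- r) ('X - z%:P) by rewrite mul_polyC.
move=> Gf; rewrite rmorphM -mulrA => If.
have {If} : I (phi (\prod_(z <- r) ('X - z%:P)) * f).
  have -> : phi (\prod_(z <- r) ('X - z%:P)) * f =
      phi l^-1%:P * (phi l%:P * (phi (\prod_(z <- r) ('X - z%:P)) * f)).
    by rewrite mulrA -rmorphM -polyCM mulVf // rmorph1 mul1r.
  exact: (idealM idI).
elim: r f Gf => [|z r IHr] f Gf; first by rewrite big_nil rmorph1 mul1r.
rewrite big_cons rmorphM -mulrA => /strip Ir.
by apply: IHr => //; apply: Ir; apply: GM.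
Qed.

End LinearFactors.

Lemma ideal2_unmixed_split (K : closedFieldType) (A : idomainType)
    (phi : {rmorphism {poly K} -> A}) c (v w s t f : A) :
    c != 0 -> (forall z, prime_elt (phi ('X - z%:P))) ->
    (forall z, ~ principal (phi ('X - z%:P)) v) ->
    (forall z, regular_mod (phi ('X - z%:P)) v w) -> koszul s t -> s != 0 ->
    ideal2 s t (phi c * f) -> ideal2 s t (v * f) -> ideal2 s t (w * f) ->
  ideal2 s t f.
Proof.
move=> c0 pr nv reg kos s0 Ic Iv Iw; have idI := ideal2_ideal s t.
pose G a := ideal2 s t (v * a) /\ ideal2 s t (w * a).
apply: (strip_linear_factors (phi := phi) (G := G) (c := c) idI) => //.
- by move=> d e [? ?]; split; rewrite mulrCA; apply: (idealM idI).
- move=> z e [Ive Iwe] Ize.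
  exact: (ideal2_unmixed (pr z) (nv z) (reg z) kos s0 Ize Ive Iwe).
Qed.

Section Unmixed.
Variable K : closedFieldType.
Local Notation R := {poly {poly {poly K}}}.
Implicit Types (p f g h : R) (z : K).

Definition lin1 z : R := ('X - z%:P)%:P%:P.

Lemma prime_XsubC z : prime_elt ('X - z%:P : {poly K}).
Proof.
apply: (prime_elt_kernel (phi := horner_eval z)) => [|p].
  by rewrite polyXsubC_eq0.
split=> [pz|[q ->]].
  by have /factor_theorem [q ->] : root p z; [apply/eqP | exists q].
by rewrite rmorphM /= /horner_eval hornerXsubC subrr mulr0.
Qed.

Lemma prime_lin1 z : prime_elt (lin1 z).
Proof. by do 2 apply: prime_elt_polyC; apply: prime_XsubC. Qed.

Lemma principal_lin1P z p :
  principal (lin1 z) p <-> map_poly (map_poly (horner_eval z)) p = 0.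
Proof.
have rootP (c : {poly K}) : principal ('X - z%:P) c <-> c.[z] = 0.
  split=> [[q ->]|/eqP/factor_theorem [q ->]]; last by exists q.
  by rewrite hornerM hornerXsubC subrr mulr0.
split=> [/principal_polyC divp|p0].
  apply/polyP => k; rewrite coef_map coef0 /=; apply/polyP => j; rewrite coef_map coef0.
  by apply/rootP; move: (divp k) => /principal_polyC.
apply/principal_polyC => k; apply/principal_polyC => j; apply/rootP.
have := congr1 (fun q : {poly {poly K}} => q`_k`_j) p0.
by rewrite !coef0 !coef_map.
Qed.

Lemma lin1_ndvd z p : p != 0 -> free_poly false true true p -> ~ principal (lin1 z) p.
Proof.
move=> p0 /free_polyP [_ _ szp] /principal_lin1P pz; case/eqP: p0.
apply/polyP => k; apply/polyP => j; rewrite !coef0.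
have := congr1 (fun q : {poly {poly K}} => q`_k`_j) pz.
rewrite !coef0 !coef_map /= /horner_eval.
by have := szp k j => /= /size1_polyC ->; rewrite hornerC => ->.
Qed.

Lemma regular_mod_lin1 z (v w : R) :
    v != 0 -> w != 0 -> free_poly false true false v -> free_poly false false true w ->
  regular_mod (lin1 z) v w.
Proof.
move=> v0 w0 Fv Fw g h /principal_lin1P.
pose phi : {rmorphism R -> {poly {poly K}}} := map_poly (map_poly (horner_eval z)).
rewrite -[LHS]/(phi _) rmorphB !rmorphM => /eqP; rewrite subr_eq0 => /eqP eq_wg.
have [_ szw2 szw1] := (free_polyP false false true w).1 Fw.
have [szv3 _ szv1] := (free_polyP false true false v).1 Fv.
have phiv : phi v = (map_poly (horner_eval z) v`_0)%:P.
  by rewrite [in LHS](size1_polyC szv3); apply: map_polyC.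
pose C (b : {poly K}) := exists2 c : K, c != 0 & b = c%:P.
have lwE : lead_coef w = ((lead_coef w)`_0`_0)%:P%:P.
  rewrite {1}(size1_polyC (szw2 (size w).-1 : (size (lead_coef w) <= 1)%N)).
  by rewrite {1}(size1_polyC (szw1 (size w).-1 0%N)).
have lw0 : (lead_coef w)`_0`_0 != 0.
  by rewrite -polyC_eq0 -polyC_eq0 -lwE lead_coef_eq0.
have lphiw : lead_coef (phi w) = ((lead_coef w)`_0`_0)%:P.
  have e : map_poly (horner_eval z) (lead_coef w) = ((lead_coef w)`_0`_0)%:P.
    by rewrite {1}lwE map_polyC /= /horner_eval hornerC.
  by rewrite -e lead_coef_map_eq //= e polyC_eq0.
have [|||_ [c c0 ->] [a aE]] :=
    @principal_lead_coef _ C (map_poly (horner_eval z) v`_0) (phi w) (phi g).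
- move=> _ _ [b b0 ->] [c c0 ->]; exists (b * c); last by rewrite polyCM.
  by rewrite mulf_eq0 negb_or b0.
- by rewrite lphiw; exists (lead_coef w)`_0`_0.
- by rewrite eq_wg phiv; exists (phi h); rewrite mulrC.
exists (map_poly (map_poly polyC) (c^-1%:P%:P * a)); apply/principal_lin1P.
rewrite -[LHS]/(phi _) rmorphB rmorphM.
have sec q : phi (map_poly (map_poly polyC) q) = q.
  apply/polyP => k; rewrite !coef_map /=; apply/polyP => j.
  by rewrite !coef_map /= /horner_eval hornerC.
rewrite sec phiv mulrCA (mulrC _%:P a) -aE mulrA -!polyCM mulVf //.
by rewrite mul1r subrr.
Qed.

(** The associated primes of a principal ideal have height one, whereas the three
polynomials have no common factor: p12 and p13 have none over K(x1), and p23 has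
no linear factor in x1. *)
Lemma principal_unmixed (s f p12 p13 p23 : R) :
    s != 0 -> p12 != 0 -> p13 != 0 -> p23 != 0 ->
    free_poly true true false p12 -> free_poly true false true p13 ->
    free_poly false true true p23 ->
    principal s (p12 * f) -> principal s (p13 * f) -> principal s (p23 * f) ->
  principal s f.
Proof.
move=> s0 p12n p13n p23n F12 F13 F23 [a aE] [b bE] div23.
have idS := principal_ideal s.
have [sz12 _ _] := (free_polyP true true false p12).1 F12.
have [_ sz13 _] := (free_polyP true false true p13).1 F13.
have p12E : p12 = (p12`_0)%:P by apply: size1_polyC.
pose C (c : {poly {poly K}}) := exists2 c0 : {poly K}, c0 != 0 & c = c0%:P.
have [|||_ [c c0 ->] [a' a'E]] := @principal_lead_coef _ C p12`_0 p13 a.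
- move=> _ _ [d d0 ->] [e e0 ->]; exists (d * e); last by rewrite polyCM.
  by rewrite mulf_eq0 negb_or d0.
- have e : lead_coef p13 = ((lead_coef p13)`_0)%:P.
    exact: size1_polyC (sz13 (size p13).-1).
  by exists (lead_coef p13)`_0 => //; rewrite -polyC_eq0 -e lead_coef_eq0.
- rewrite -p12E; exists b; apply: (mulIf s0).
  transitivity (p13 * (p12 * f)); first by rewrite aE; ring.
  by rewrite mulrCA bE; ring.
have divc : principal s (c%:P%:P * f).
  exists a'; apply: (mulfI p12n).
  transitivity (c%:P%:P * (p12 * f)); first by ring.
  by rewrite aE mulrA a'E -p12E; ring.
apply: (@strip_linear_factors K R (polyC \o polyC) (principal s)
  (fun f => principal s (p23 * f)) c) => //.
- by move=> d e dive; rewrite mulrCA; apply: (idealM idS).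
- move=> z e div23e divz; apply: principal_unmixed_prime (prime_lin1 z) _ s0 divz div23e.
  exact: lin1_ndvd.
Qed.

(** The elements s and t involve an extra indeterminate, which is the reason for
the constants p1, p2 and p3. *)
Lemma ideal2_unmixed_poly (s t f : {poly R}) (p1 p2 p3 : R) :
    s != 0 -> koszul s t -> p1 != 0 -> p2 != 0 -> p3 != 0 ->
    free_poly true false false p1 -> free_poly false true false p2 ->
    free_poly false false true p3 ->
    ideal2 s t (p1%:P * f) -> ideal2 s t (p2%:P * f) -> ideal2 s t (p3%:P * f) ->
  ideal2 s t f.
Proof.
move=> s0 kos p1n p2n p3n F1 F2 F3 I1 I2 I3.
have [sz3 sz2 _] := (free_polyP true false false p1).1 F1.
have p1E : p1 = (p1`_0`_0)%:P%:P.
  by rewrite {1}(size1_polyC sz3) {1}(size1_polyC (sz2 0%N)).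
have c0 : p1`_0`_0 != 0 by rewrite -polyC_eq0 -polyC_eq0 -p1E.
pose phi : {rmorphism {poly K} -> {poly R}} := polyC \o (polyC \o polyC).
have phiE z : phi ('X - z%:P) = (lin1 z)%:P by [].
apply: (@ideal2_unmixed_split K _ phi p1`_0`_0 p2%:P p3%:P) => // [z|z|z|].
- exact: prime_elt_polyC (prime_lin1 z).
- move=> /principal_polyC /(_ 0%N); rewrite coefC /=; apply: lin1_ndvd => //.
  exact: free_poly_sub F2.
- exact: regular_mod_polyC (regular_mod_lin1 (z := z) p2n p3n F2 F3).
- by rewrite -[phi _]/(p1`_0`_0)%:P%:P%:P -p1E.
Qed.

End Unmixed.

(** * The Bezout bound for incomparable prime ideals *)

Section Primes.
Variable K : closedFieldType.
Local Notation R := {poly {poly {poly K}}}.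
Local Notation y := (y K).
Local Notation cst := (cst K).

Lemma trans_free F1 F2 F3 g (p : R) :
  free_poly F1 F2 F3 p -> free_poly F1 F2 F3 (trans g p).
Proof. by move=> [D bp]; exists D; apply: trans_box. Qed.

Lemma free_poly_subspace F1 F2 F3 : is_subspace (free_poly F1 F2 F3 : R -> Prop).
Proof.
split=> [p q /free_polyP [p3 p2 p1] /free_polyP [q3 q2 q1]|c p /free_polyP [p3 p2 p1]].
  have sz (B : nzRingType) (F : bool) (a b : {poly B}) :
      F || (size a <= 1)%N -> F || (size b <= 1)%N -> F || (size (a - b)%R <= 1)%N.
    case: F => //= sza szb; apply: leq_trans (size_polyD _ _) _.
    by rewrite size_polyN geq_max sza.
  by apply/free_polyP; split=> [|k|k j]; rewrite ?coefB; apply: sz.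
have sz (A : comNzRingType) (F : bool) (a : A) (b : {poly A}) :
    F || (size b <= 1)%N -> F || (size (a%:P * b)%R <= 1)%N.
  by case: F => //= szb; rewrite mul_polyC; apply: leq_trans (size_scale_leq _ _) szb.
by apply/free_polyP; split=> [|k|k j]; rewrite /cst /= ?coefCM; apply: sz.
Qed.

(** The multiplicative set consists of the nonzero polynomials in the selected
variables times powers of y, because only the zeros with y nonzero matter. *)
Lemma generated_meets_or_prime F1 F2 F3 (W : seq R) :
  (exists p k, [/\ p != 0, free_poly F1 F2 F3 p & generated W (y ^+ k * p)]) \/
  (exists P, [/\ is_prime P, forall w, w \in W -> P w, ~ P y &
     forall p, free_poly F1 F2 F3 p -> P p -> p = 0]).
Proof.
pose S (a : R) := exists p k, [/\ p != 0, free_poly F1 F2 F3 p & a = y ^+ k * p].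
case: (boolp.EM (exists a, S a /\ generated W a)) => [[_ [[p [k [p0 Fp ->]]] Wa]]|noS].
  by left; exists p, k.
have [|||P [prP WP PS]] := prime_avoiding (I := generated W) (S := S) (generated_ideal W).
- exists 1, 0; split; [exact: oner_neq0 | exact: free_poly1 | by rewrite mulr1].
- move=> _ _ [p [k [p0 Fp ->]]] [q [l [q0 Fq ->]]]; exists (p * q), (k + l)%N.
  by split; [rewrite mulf_neq0 | exact: free_polyM | rewrite exprD mulrACA].
- by move=> a Wa Sa; apply: noS; exists a.
right; exists P; split=> // [w Ww|Py|p Fp Pp].
- by apply: WP => I idI; apply.
- apply: (PS _ Py); exists 1, 1; split; [exact: oner_neq0 | exact: free_poly1|].
  by rewrite mulr1 expr1.
- apply: boolp.contrapT => p0; apply: (PS _ Pp); exists p, 0.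
  by split=> //; [apply/eqP | rewrite expr0 mul1r].
Qed.

Lemma prime_generated P (W : seq R) k p :
  is_prime P -> (forall w, w \in W -> P w) -> ~ P y -> generated W (y ^+ k * p) -> P p.
Proof.
move=> prP PW nPy /(_ P prP PW) /(primeM prP) [/(primeX prP)|] //.
Qed.

Lemma trans0 p : trans (0 : grpG K) p = p.
Proof.
have [e1 e2 e3] := @Defs.coord0 K.
have ext := hom_ext (phi := trans 0) (psi := idfun : {rmorphism R -> R}).
apply: ext => [c|||].
- exact: trans_cst.
- by rewrite trans_x1 e1 rmorph0 addr0.
- by rewrite trans_x2 e2 rmorph0 addr0.
- by rewrite trans_y e3 rmorph1 mul1r.
Qed.

(** If P is the ideal of Z, then this is the ideal of Z + g. *)
Definition translate (P : R -> Prop) (g : grpG K) p := P (trans g p).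

Lemma translate_prime P g : is_prime P -> is_prime (translate P g).
Proof.
move=> prP; rewrite /translate; split=> [|P1|a b].
- split=> [|a b Pa Pb|a b Pb]; first by rewrite rmorph0; apply: (ideal0 prP).
    by rewrite rmorphD; apply: (idealD prP).
  by rewrite rmorphM; apply: (idealM prP).
- by apply: (prime1 prP); rewrite rmorph1 in P1.
- by rewrite rmorphM; apply: primeM.
Qed.

Lemma translate_incomparable P g h : ~ stab P (g - h) ->
  exists p, translate P h p /\ ~ translate P g p.
Proof.
move=> nstab; apply: boolp.contrapT => nop; apply: nstab => p Pp.
apply: boolp.contrapT => nP; apply: nop; exists (trans (- h) p).
by rewrite /translate !trans_comp subrr trans0.
Qed.

(** The base family is made of the products f i * u l, where f i lies in all the
prime ideals but the i-th one. *)
Lemma bezout_primes F1 F2 F3 K1 K2 K3 n e (J : finType) (P : J -> R -> Prop)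
    (u : 'I_e -> R) :
    (forall i, is_prime (P i)) ->
    (forall i j, i != j -> exists p, P j p /\ ~ P i p) ->
    (forall i (q : 'I_e -> R), (forall l, free_poly F1 F2 F3 (q l)) ->
       P i (\sum_l q l * u l) -> forall l, q l = 0) ->
    regular_chain
      (poly_box (poly_box (box K1.+1 K2.+1 K3.+1) n.+1) n.+1 : {poly {poly R}} -> Prop)
      (coef_ideal (coef_ideal (fun p => forall i, P i p)))
      (~~ F1 + ~~ F2 + ~~ F3) (fun a => a = 0) ->
  (#|J| * e <= (~~ F1 + ~~ F2 + ~~ F3)`! *
     ((if F1 then 1 else K1) * (if F2 then 1 else K2) * (if F3 then 1 else K3)))%N.
Proof.
move=> prP incP indu chain.
have /fin_all_exists [f fP] (i : J) : exists fi, ~ P i fi /\ forall j, j != i -> P j fi.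
  have /fin_all_exists [p pP] (j : J) : exists p, ~ P i p /\ (j != i -> P j p).
    case: (eqVneq j i) => [->|neq_ji]; first by exists 1; split=> //; apply: prime1.
    have [|p [Pjp nPip]] := incP i j; first by rewrite eq_sym.
    by exists p.
  exists (\prod_j p j); split=> [|j neq_ji].
    elim/big_ind: _ => [|a b nPa nPb|j _]; first exact: prime1.
      by move=> /(primeM (prP i)) [].
    by case: (pP j).
  rewrite (bigD1 j) //= mulrC; apply: (idealM (prP j)).
  by case: (pP j) => _; apply.
have := @bezout_bound K F1 F2 F3 K1 K2 K3 n (fun p => forall i, P i p)
  (J * 'I_e)%type (fun x => f x.1 * u x.2).
rewrite card_prod card_ord; apply=> //.
  split=> [i|a b Pa Pb i|a b Pb i]; first exact: (ideal0 (prP i)).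
    exact: (idealD (prP i)).
  exact: (idealM (prP i)).
move=> q Fq Pq [i l]; apply: (indu i (fun l => q (i, l))) => // {l}.
have {Pq} := Pq i.
rewrite (eq_bigr (fun x => q (x.1, x.2) * (f x.1 * u x.2))) => [|[]//].
rewrite -(pair_bigA _ (fun i l => q (i, l) * (f i * u l))) /=.
move=> /(prime_sum_single (i := i) (prP i)) Pi.
have : P i (f i * \sum_l q (i, l) * u l).
  rewrite mulr_sumr (eq_bigr (fun l => q (i, l) * (f i * u l))).
    apply: Pi => j neq_ji; apply: ideal_sum => [|l _]; first exact: (prP i).
    rewrite mulrCA mulrC; apply: (idealM (prP i)); case: (fP j) => _; apply.
    by rewrite eq_sym.
  by move=> l _; rewrite mulrCA.
by move=> /(primeM (prP i)) [] //; case: (fP i).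
Qed.

End Primes.

(** * Regular chains made of generic combinations *)

Section Chains.
Variables (R : idomainType) (B : R -> Prop) (n : nat) (y s : R) (W1 W2 : seq R).
Hypotheses (B0 : B 0) (Bs : B s).
Hypothesis BW1 : forall w, w \in W1 -> B w.
Hypothesis BW2 : forall w, w \in W2 -> B w.
Hypotheses (size_W1 : (size W1 <= n)%N) (size_W2 : (size W2 <= n)%N).
Hypothesis s0 : s != 0.

Local Notation Q := {poly {poly R}}.
Local Notation deg := (poly_box (poly_box B n.+1) n.+1 : Q -> Prop).

(** The powers of the new variable play the role of the coefficients of a general
linear combination of W. *)
Definition generic (A : nzRingType) (W : seq A) : {poly A} :=
  \poly_(i < size W) W`_i.

Lemma coef_generic (A : nzRingType) (W : seq A) (C : A -> Prop) i :
  C 0 -> (forall w, w \in W -> C w) -> C (generic W)`_i.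
Proof. by move=> C0 BW; rewrite coef_poly; case: ltnP => // ?; apply/BW/mem_nth. Qed.

Lemma poly_box_generic (A : comNzRingType) (W : seq A) (C : A -> Prop) d :
  C 0 -> (forall w, w \in W -> C w) -> (size W <= d)%N -> poly_box C d.+1 (generic W).
Proof.
move=> C0 BW le_d; split=> [|i]; last exact: coef_generic.
exact: leq_trans (size_poly _ _) (leqW le_d).
Qed.

Lemma poly_boxC (A : comNzRingType) (C : A -> Prop) d a :
  C 0 -> C a -> poly_box C d.+1 a%:P.
Proof.
move=> C0 Ca; split=> [|i]; last by rewrite coefC; case: ifP.
exact: leq_trans (size_polyC_leq1 a) _.
Qed.

Let B0n : poly_box B n.+1 0.
Proof. by split=> [|i]; rewrite ?size_poly0 ?coef0. Qed.

Lemma regular_coef (A : idomainType) (I : A -> Prop) f (a : {poly A}) :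
  (forall b, I (f * b) -> I b) -> coef_ideal I (f%:P * a) -> coef_ideal I a.
Proof. by move=> regf Ifa i; apply: regf; rewrite -coefCM. Qed.

Lemma coef_idealC (A : comNzRingType) (I : A -> Prop) a :
  is_ideal I -> I a -> coef_ideal I a%:P.
Proof. by move=> idI Ia i; rewrite coefC; case: ifP => // _; apply: (ideal0 idI). Qed.

Lemma coef_ideal_sub (A : comNzRingType) (I J : A -> Prop) (a : {poly A}) :
  (forall b, I b -> J b) -> coef_ideal I a -> coef_ideal J a.
Proof. by move=> sub Ia i; apply: sub. Qed.

Variable V : R -> Prop.
Hypotheses (idV : is_ideal V) (Vs : V s).

Let idVV : is_ideal (coef_ideal (coef_ideal V)).
Proof. by do 2 apply: coef_idealP. Qed.

Let idI1 : is_ideal (coef_ideal (coef_ideal (principal s))).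
Proof. by do 2 apply: coef_idealP; apply: principal_ideal. Qed.

Lemma chain1 : regular_chain deg (coef_ideal (coef_ideal V)) 1 (fun a => a = 0).
Proof.
apply: (RegularChainS (f := s%:P%:P) _ idVV); last exact: RegularChain0.
- exact: zero_ideal.
- by move=> _ ->; apply: (ideal0 idVV).
- exact: (coef_idealC (coef_idealP idV) (coef_idealC idV Vs)).
- by apply: poly_boxC => //; apply: poly_boxC.
- by move=> a /eqP; rewrite mulf_eq0 !polyC_eq0 (negPf s0) => /eqP.
Qed.

Hypothesis VW1 : forall w, w \in W1 -> V w.
Hypothesis regW1 :
  forall c, (forall w, w \in W1 -> principal s (c * w)) -> principal s c.

Let regular_W1 a : coef_ideal (principal s) (generic W1 * a) ->
  coef_ideal (principal s) a.
Proof.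
apply: mccoy; first exact: principal_ideal.
move=> c divc; apply: regW1 => w Ww; have := divc (index w W1).
by rewrite coef_poly index_mem Ww nth_index.
Qed.

Lemma chain_first r :
  regular_chain deg (coef_ideal (coef_ideal V)) r (coef_ideal (coef_ideal (principal s))) ->
  regular_chain deg (coef_ideal (coef_ideal V)) r.+1 (fun a => a = 0).
Proof.
apply: (RegularChainS (f := s%:P%:P) _ idI1).
- exact: zero_ideal.
- by move=> _ ->; apply: (ideal0 idI1).
- have idS := principal_ideal s; have Ss : principal s s by exists 1; rewrite mul1r.
  exact: (coef_idealC (coef_idealP idS) (coef_idealC idS Ss)).
- by apply: poly_boxC => //; apply: poly_boxC.
- move=> a /eqP; rewrite mulf_eq0 !polyC_eq0 (negPf s0) => /eqP ->; exact: erefl.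
Qed.

Lemma chain2 : regular_chain deg (coef_ideal (coef_ideal V)) 2 (fun a => a = 0).
Proof.
apply: chain_first.
apply: (RegularChainS (f := (generic W1)%:P) idI1 idVV); last exact: RegularChain0.
- move=> a; apply: coef_ideal_sub => b; apply: coef_ideal_sub => _ [c ->].
  exact: (idealM idV).
- apply: (coef_idealC (coef_idealP idV)) => i.
  by apply: coef_generic => //; apply: (ideal0 idV).
- by apply: poly_boxC => //; apply: poly_box_generic.
- move=> a; exact: (regular_coef regular_W1).
Qed.

(** Powers of y are removed from the ideal of s and the generic combination of
W1, because nothing is known about the common zeros with y = 0. *)
Definition saturation (a : {poly R}) :=
  exists k, ideal2 s%:P (generic W1) ((y ^+ k)%:P * a).

Lemma saturation_ideal : is_ideal saturation.
Proof.
have id2 := ideal2_ideal s%:P (generic W1); split.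
- by exists 0; rewrite mulr0; apply: (ideal0 id2).
- move=> a b [k Ia] [l Ib]; exists (k + l)%N.
  have -> : (y ^+ (k + l))%:P * (a + b) =
      (y ^+ l)%:P * ((y ^+ k)%:P * a) + (y ^+ k)%:P * ((y ^+ l)%:P * b).
    by rewrite !mulrA -!polyCM -!exprD addnC mulrDr addnC.
  by apply: (idealD id2); apply: (idealM id2).
- by move=> a b [k Ib]; exists k; rewrite mulrCA; apply: (idealM id2).
Qed.

Lemma regular_saturation p1 p2 p3 k1 k2 k3 (c : {poly R}) :
    (forall f, let I := ideal2 s%:P (generic W1) in
       I (p1%:P * f) -> I (p2%:P * f) -> I (p3%:P * f) -> I f) ->
    generated W2 (y ^+ k1 * p1) -> generated W2 (y ^+ k2 * p2) ->
    generated W2 (y ^+ k3 * p3) ->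
  (forall w, w \in W2 -> saturation (c * w%:P)) -> saturation c.
Proof.
move=> unmixed I1 I2 I3 satc; have idS := saturation_ideal.
have id2 := ideal2_ideal s%:P (generic W1).
pose I (p : R) := saturation (c * p%:P).
have idI : is_ideal I.
  split=> [|p q Ip Iq|p q Iq]; rewrite /I.
  - by rewrite mulr0; apply: (ideal0 idS).
  - by rewrite polyCD mulrDr; apply: (idealD idS).
  - by rewrite polyCM mulrCA; apply: (idealM idS).
have sat k p : generated W2 (y ^+ k * p) ->
    exists l, ideal2 s%:P (generic W1) (p%:P * ((y ^+ l)%:P * c)).
  move=> /(_ I idI satc) [l Il]; exists (k + l)%N; move: Il.
  by rewrite exprD !polyCM; congr ideal2; ring.
have [[l1 {}I1] [l2 {}I2] [l3 {}I3]] := And3 (sat _ _ I1) (sat _ _ I2) (sat _ _ I3).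
exists (l1 + l2 + l3)%N; apply: unmixed.
- have -> : p1%:P * ((y ^+ (l1 + l2 + l3))%:P * c)
      = (y ^+ (l2 + l3))%:P * (p1%:P * ((y ^+ l1)%:P * c)).
    by rewrite !exprD !polyCM; ring.
  exact: (idealM id2).
- have -> : p2%:P * ((y ^+ (l1 + l2 + l3))%:P * c)
      = (y ^+ (l1 + l3))%:P * (p2%:P * ((y ^+ l2)%:P * c)).
    by rewrite !exprD !polyCM; ring.
  exact: (idealM id2).
- have -> : p3%:P * ((y ^+ (l1 + l2 + l3))%:P * c)
      = (y ^+ (l1 + l2))%:P * (p3%:P * ((y ^+ l3)%:P * c)).
    by rewrite !exprD !polyCM; ring.
  exact: (idealM id2).
Qed.

Hypothesis Vy : forall a, V (y * a) -> V a.
Hypothesis VW2 : forall w, w \in W2 -> V w.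
Hypothesis regW2 :
  forall c, (forall w, w \in W2 -> saturation (c * w%:P)) -> saturation c.

Lemma chain3 : regular_chain deg (coef_ideal (coef_ideal V)) 3 (fun a => a = 0).
Proof.
have idS := saturation_ideal.
apply: chain_first.
apply: (RegularChainS (f := (generic W1)%:P) idI1 (coef_idealP idS)).
- move=> b; apply: coef_ideal_sub => a diva; exists 0; rewrite expr0 mul1r.
  have /principal_polyC [c ->] := diva.
  by exists c, 0; rewrite mul0r addr0.
- apply: (coef_idealC idS); exists 0; rewrite expr0 mul1r.
  by exists 0, 1; rewrite mul0r add0r mul1r.
- by apply: poly_boxC => //; apply: poly_box_generic.
- move=> a; exact: (regular_coef regular_W1).
apply: (RegularChainS (f := generic [seq w%:P | w <- W2]) (coef_idealP idS) idVV);
  last exact: RegularChain0.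
- move=> b; apply: coef_ideal_sub => a [k [p [q ya]]] i.
  have : V (y ^+ k * a`_i).
    rewrite -coefCM ya coefD coefMC; apply: (idealD idV); first exact: (idealM idV).
    rewrite coefM; apply: ideal_sum => // j _; apply: (idealM idV).
    by apply: coef_generic => //; apply: (ideal0 idV).
  elim: k {ya} => [|k IHk]; first by rewrite expr0 mul1r.
  by rewrite exprS -mulrA => /Vy.
- move=> i; apply: coef_generic => [|_ /mapP [w Ww ->]].
    exact: (ideal0 (coef_idealP idV)).
  by apply: (coef_idealC idV); apply: VW2.
- apply: poly_box_generic => [//|_ /mapP [w Ww ->]|]; last by rewrite size_map.
  by apply: poly_boxC => //; apply: BW2.
- move=> a; apply: mccoy => // c Ic; apply: regW2 => w Ww.
  have := Ic (index w W2); rewrite coef_poly size_map index_mem Ww.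
  by rewrite (nth_map 0) ?index_mem // nth_index.
Qed.

End Chains.

(** * The zero estimate *)

Lemma fset_representatives (T : choiceType) (U : choiceType) (S : {fset T}) (f : T -> U) :
  exists (J : finType) (g : J -> T),
    [/\ #|J| = #|` [fset f x | x in S]|, forall j, g j \in S &
        forall i j, i != j -> f (g i) <> f (g j)].
Proof.
pose X := [fset f x | x in S].
have /fin_all_exists [g gP] (j : X) : exists x, x \in S /\ f x = val j.
  by have /imfsetP [x /= Sx ->] := valP j; exists x.
exists X, g; split=> [|j|i j neq_ij]; first by rewrite -cardfE.
  by case: (gP j).
case: (gP i) (gP j) => _ -> [_ ->] /val_inj eq_ij.
by rewrite eq_ij eqxx in neq_ij.
Qed.

Lemma card_pow_image (K : fieldType) (X : {fset K}) e : (0 < e)%N ->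
  (#|` X| <= #|` [fset x ^+ e | x in X]| * e)%N.
Proof.
move=> e0; set Z := [fset x ^+ e | x in X].
have pow_in (x : X) : val x ^+ e \in Z by apply: in_imfset; apply: valP.
rewrite [#|` X|]cardfE -sum1_card (partition_big (fun x : X => [` pow_in x]%fset) predT) //=.
rewrite [#|` Z|]cardfE -sum_nat_const; apply: leq_sum => z _.
rewrite sum1dep_card; set A := [set x | _].
have szp : size ('X^e - (val z)%:P : {poly K}) = e.+1 by rewrite size_XnsubC.
have := max_poly_roots (p := 'X^e - (val z)%:P) (rs := [seq val x | x in A]).
rewrite szp size_map -cardE; apply.
- by rewrite -size_poly_eq0 szp.
- apply/allP => x /mapP [a]; rewrite mem_enum inE => /eqP az ->.
  by rewrite rootE !hornerE -az subrr.
- by rewrite map_inj_uniq ?enum_uniq //; apply: val_inj.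
Qed.

Lemma morphism_separates (K : fieldType) (A : comNzRingType)
    (iota : {rmorphism K -> A}) (phi psi : {rmorphism A -> K}) :
    ~ (phi =1 psi) -> (forall c, phi (iota c) = c) -> (forall c, psi (iota c) = c) ->
  exists p, psi p = 0 /\ phi p <> 0.
Proof.
move=> neq phiK psiK; apply: boolp.contrapT => nosep; apply: neq => p.
apply/eqP; rewrite -subr_eq0; apply/eqP; apply: boolp.contrapT => neqp.
apply: nosep; exists (p - iota (psi p)).
by rewrite !rmorphB phiK psiK subrr.
Qed.

Section ZeroEstimate.
Variable K : closedFieldType.
Hypothesis charK0 : [pchar K] =i pred0.
Local Notation R := {poly {poly {poly K}}}.
Local Notation y := (y K).
Local Notation cst := (cst K).

Variables (K1 K2 L : nat) (S1 S2 S3 : {fset grpG K}) (s : R).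
Hypotheses (S1_0 : 0 \in S1) (S2_0 : 0 \in S2).
Hypothesis S1_x : forall a b : K, (a, b) <> (0, 0) ->
  (#|` [fset (a * coordX1 g + b * coordX2 g)%R | g in S1] | > maxn K1 K2)%N.
Hypothesis S1_y : (#|` [fset coordY g | g in S1] | > L)%N.
Hypothesis S2_xy : forall a b : K, (a, b) <> (0, 0) ->
  (#|` [fset (a * coordX1 g + b * coordX2 g, coordY g)%R | g in S2] |
    > 2 * maxn K1 K2 * L)%N.
Hypothesis S2_xx :
  (#|` [fset (coordX1 g, coordX2 g) | g in S2] | > 2 * K1 * K2)%N.
Hypothesis box_s : box K1.+1 K2.+1 L.+1 s.
Hypothesis s_y : s`_0 != 0.

Let W1 := [seq trans g s | g <- S1].
Let W2 := [seq trans (g + h) s | g <- S1, h <- S2].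
Let n := maxn (size W1) (size W2).

Let s0 : s != 0.
Proof. by apply: contra_neq s_y => ->; rewrite coef0. Qed.

Let B := box K1.+1 K2.+1 L.+1 : R -> Prop.

Let B0 : B 0.
Proof. exact: pred_0 (box_additive _ _ _ _). Qed.

Let BW1 w : w \in W1 -> B w.
Proof. by move=> /mapP [g _ ->]; apply: trans_box. Qed.

Let BW2 w : w \in W2 -> B w.
Proof. by move=> /allpairsP [[g h] [_ _ ->]]; apply: trans_box. Qed.

Let W1s : s \in W1.
Proof. by apply/mapP; exists 0; rewrite ?trans0. Qed.

Let W12 w : w \in W1 -> w \in W2.
Proof.
move=> /mapP [g S1g ->]; apply/allpairsP; exists (g, 0).
by split=> //=; rewrite addr0.
Qed.

Lemma trans_inj0 g (p : R) : trans g p = 0 -> p = 0.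
Proof. by move=> p0; apply/eqP; rewrite -size_poly_eq0 -(size_trans g) p0 size_poly0. Qed.

Lemma no_free_multiplier F1 F2 F3 (P : R -> Prop) g (q : 'I_1 -> R) :
    (forall p, free_poly F1 F2 F3 p -> P p -> p = 0) ->
    (forall l, free_poly F1 F2 F3 (q l)) ->
  translate P g (\sum_l q l * 1) -> forall l, q l = 0.
Proof.
move=> noF Fq; rewrite big_ord1 mulr1 /translate => Pq l; rewrite ord1.
by apply: (@trans_inj0 g); apply: noF => //; apply: trans_free.
Qed.

(** All the translates of P by the elements g j of S1 contain s. *)
Lemma bezout_codim1 F1 F2 F3 (P : R -> Prop) (J : finType) (g : J -> grpG K) e
    (u : 'I_e -> R) :
    (~~ F1 + ~~ F2 + ~~ F3 = 1)%N -> is_prime P -> (forall w, w \in W1 -> P w) ->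
    (forall j, g j \in S1) -> (forall i j, i != j -> ~ stab P (g i - g j)) ->
    (forall g (q : 'I_e -> R), (forall l, free_poly F1 F2 F3 (q l)) ->
       translate P g (\sum_l q l * u l) -> forall l, q l = 0) ->
  (#|J| * e <= (if F1 then 1 else K1) * (if F2 then 1 else K2) * (if F3 then 1 else L))%N.
Proof.
move=> r1 prP PW1 S1g nstab indu.
have prPg j : is_prime (translate P (g j)) by apply: translate_prime.
have idV : is_ideal (fun p => forall j, translate P (g j) p).
  split=> [i|a b Pa Pb i|a b Pb i]; first exact: (ideal0 (prPg i)).
    exact: (idealD (prPg i)).
  exact: (idealM (prPg i)).
have := @bezout_primes K F1 F2 F3 K1 K2 L n e J (fun j => translate P (g j)) u.
rewrite r1 mul1n; apply=> //.
- by move=> i j neq_ij; apply: translate_incomparable; apply: nstab.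
- by move=> i q; apply: indu.
- have Vs j : translate P (g j) s by apply: PW1; apply/mapP; exists (g j).
  exact: (chain1 n B0 box_s s0 idV Vs).
Qed.

(** All the translates of P by the elements g j of S2 contain the translates of s
by S1, hence s and their generic combination. *)
Lemma bezout_codim2 F1 F2 F3 (P : R -> Prop) (J : finType) (g : J -> grpG K) :
    (~~ F1 + ~~ F2 + ~~ F3 = 2)%N ->
    (forall c, (forall w, w \in W1 -> principal s (c * w)) -> principal s c) ->
    is_prime P -> (forall w, w \in W2 -> P w) ->
    (forall j, g j \in S2) -> (forall i j, i != j -> ~ stab P (g i - g j)) ->
    (forall p, free_poly F1 F2 F3 p -> P p -> p = 0) ->
  (#|J| <= 2 * ((if F1 then 1 else K1) * (if F2 then 1 else K2)
                * (if F3 then 1 else L)))%N.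
Proof.
move=> r2 regW1 prP PW2 S2g nstab noF.
have prPg j : is_prime (translate P (g j)) by apply: translate_prime.
have idV : is_ideal (fun p => forall j, translate P (g j) p).
  split=> [i|a b Pa Pb i|a b Pb i]; first exact: (ideal0 (prPg i)).
    exact: (idealD (prPg i)).
  exact: (idealM (prPg i)).
have VW1 w : w \in W1 -> forall j, translate P (g j) w.
  move=> /mapP [g' S1g' ->] j; apply: PW2; rewrite trans_comp addrC.
  by apply/allpairsP; exists (g', g j); split=> //; apply: S2g.
have := @bezout_primes K F1 F2 F3 K1 K2 L n 1 J (fun j => translate P (g j)) (fun=> 1).
rewrite r2 muln1; apply=> //.
- by move=> i j neq_ij; apply: translate_incomparable; apply: nstab.
- by move=> i q; apply: no_free_multiplier.
- exact: (chain2 B0 box_s BW1 (leq_maxl _ _) s0 idV (VW1 s W1s) VW1 regW1).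
Qed.

Lemma coordB (g h : grpG K) :
  [/\ coordX1 (g - h) = coordX1 g - coordX1 h, coordX2 (g - h) = coordX2 g - coordX2 h
    & coordY (g - h) = coordY g / coordY h].
Proof. by []. Qed.

Let ex_s (P : R -> Prop) : (forall w, w \in W1 -> P w) -> exists p, P p /\ p != 0.
Proof. by move=> PW1; exists s; split; [apply: PW1 | apply: s0]. Qed.

(** Otherwise W1 is contained in a prime ideal whose stabilizer moves x along one
line only; by the hypothesis on the projections of S1, it has more than
max(K1, K2) translates that contain s, which is more than the degree of s in x1
or in x2 allows. *)
Lemma ideal1_meets_y (b : bool) : exists p k,
  [/\ p != 0, free_poly b (~~ b) true p & generated W1 (y ^+ k * p)].
Proof.
case: (generated_meets_or_prime b (~~ b) true W1) => // -[P [prP PW1 _ noF]].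
have [|ab [ab0 line _ _]] := stab_line charK0 (ideal_subspace prP) (ex_s PW1).
  by move=> p Pp Fp; apply: noF => //; apply: free_poly_sub Fp.
have [J [g [cardJ S1g neqg]]] := fset_representatives S1
  (fun g => ab.1 * coordX1 g + ab.2 * coordX2 g).
have : (#|J| * 1 <= (if b then 1 else K1) * (if ~~ b then 1 else K2) * 1)%N.
  apply: (bezout_codim1 (F1 := b) (F2 := ~~ b) (F3 := true)
    (u := fun _ : 'I_1 => 1) _ prP PW1 S1g) => //.
  - by case: (b).
  - move=> i j neq_ij /line; have [-> -> _] := coordB (g i) (g j) => eq0.
    apply: (neqg i j neq_ij); apply/eqP; rewrite -subr_eq0 -eq0; apply/eqP; ring.
  - by move=> g' q; apply: no_free_multiplier.
have : ((if b then 1 else K1) * (if ~~ b then 1 else K2) * 1 <= maxn K1 K2)%N.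
  by case: (b); rewrite /= ?mul1n !muln1 ?leq_maxr ?leq_maxl.
have : (maxn K1 K2 < #|J|)%N.
  by rewrite cardJ; apply: S1_x => ab0'; apply: ab0; rewrite -ab0'; case: (ab).
rewrite (muln1 #|J|) => lt1 le2 le3.
by have := leq_trans lt1 (leq_trans le3 le2); rewrite ltnn.
Qed.

(** Here the translations that stabilise the prime ideal P may act on y by e-th
roots of unity, where e is the least degree in y of a nonzero element of P, so
that P may have fewer than L + 1 translates by S1. This loss of a factor e is
compensated because 1, y, ..., y^(e-1) are independent modulo P over K[x1, x2]. *)
Lemma ideal1_meets_xx : exists p k,
  [/\ p != 0, free_poly true true false p & generated W1 (y ^+ k * p)].
Proof.
case: (generated_meets_or_prime true true false W1) => // -[P [prP PW1 nPy noF]].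
have [h [Ph h0 min_h inv_h]] := ex_eigenvector (ideal_subspace prP) (ex_s PW1).
set e := (size h).-1 in inv_h.
have szh : size h = e.+1 by rewrite prednK // size_poly_gt0.
have e0 : (0 < e)%N.
  rewrite lt0n; apply/eqP => e0; case/eqP: h0; apply: noF => //.
  by apply/free_polyP; split; rewrite ?szh ?e0.
(* If y divides h, then the quotient also belongs to P. *)
have h00 : h`_0 != 0.
  apply/eqP => h00; have [h' hE] : exists h', h = h' * y.
    exists (\poly_(i < e) h`_i.+1); apply/polyP => -[|i]; rewrite coefMX //= coef_poly.
    by case: ltnP => // le_e; rewrite nth_default // szh.
  have [Ph'|//] : P h' \/ P y by apply: (primeM prP); rewrite -hE.
  have h'0 : h' != 0 by apply: contra_neq h0 => h'0; rewrite hE h'0 mul0r.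
  by have := min_h h' Ph' h'0; rewrite hE size_mulX // ltnn.
have stab_pow g : stab P g -> coordY g ^+ e = 1.
  by move=> /inv_h /(_ _ h00) [<- _]; rewrite expr0.
have [J [g [cardJ S1g neqg]]] := fset_representatives S1 (fun g => coordY g ^+ e).
have bound : (#|J| * e <= 1 * 1 * L)%N.
  apply: (bezout_codim1 (F1 := true) (F2 := true) (F3 := false)
    (u := fun l : 'I_e => y ^+ l) _ prP PW1 S1g) => //.
  - move=> i j neq_ij /stab_pow; have [_ _ ->] := coordB (g i) (g j).
    rewrite expr_div_n => /(canRL (divfK _)); rewrite mul1r => eqg.
    apply: (neqg i j neq_ij); apply: eqg.
    by rewrite expf_neq0 // coordY_neq0.
  - move=> g' q Fq Pq l; set p := \sum_l _ in Pq.
    have qE l' : q l' = ((q l')`_0)%:P.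
      by apply: size1_polyC; have /free_polyP [] := Fq l'.
    have pE : p = \poly_(i < e) (if insub i is Some l' then (q l')`_0 else 0).
      rewrite poly_def; apply: eq_bigr => l' _.
      by rewrite valK {1}qE mul_polyC.
    have p0 : p = 0.
      apply: (@trans_inj0 g'); apply/eqP; apply: contraT => tp0.
      have := min_h _ Pq tp0; rewrite size_trans szh pE.
      by rewrite ltnNge size_poly.
    have := congr1 (fun p : R => p`_l) p0; rewrite pE coef_poly ltn_ord valK coef0.
    by move=> ql0; rewrite qE ql0 polyC0.
have card_le := leq_trans (card_pow_image [fset coordY g | g in S1] e0) _.
have : (#|` [fset coordY g | g in S1]| <= L)%N.
  apply: card_le; rewrite !mul1n in bound; apply: leq_trans bound; rewrite cardJ.
  rewrite leq_mul2r; apply/orP; right; apply: fsubset_leq_card; apply/fsubsetP => z.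
  move=> /imfsetP [_ /imfsetP [a S1a ->] ->]; apply/imfsetP; by exists a.
by rewrite leqNgt S1_y.
Qed.

Lemma regular_W1 c : (forall w, w \in W1 -> principal s (c * w)) -> principal s c.
Proof.
move=> divc; have idS := principal_ideal s.
have strip k p : principal s (y ^+ k * p) -> principal s p.
  elim: k => [|k IHk]; first by rewrite expr0 mul1r.
  rewrite exprS -mulrA => -[a aE]; apply: IHk.
  have a0 : a`_0 = 0.
    have := congr1 (fun p : R => p`_0) aE; rewrite coefXM /= coef0M => /esym/eqP.
    by rewrite mulf_eq0 (negPf s_y) orbF => /eqP.
  exists (\poly_(i < size a) a`_i.+1); apply: (mulfI (_ : y != 0)).
    by rewrite -size_poly_gt0 size_polyX.
  rewrite aE mulrA; congr (_ * s); apply/polyP => -[|i]; rewrite coefXM //= coef_poly.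
  by case: ltnP => // le_i; rewrite nth_default // (leq_trans le_i).
have div k p : generated W1 (y ^+ k * p) -> principal s (p * c).
  move=> /(generated_colon idS divc); rewrite mulrCA (mulrC c) => /strip.
  exact.
have [p12 [k12 [n12 F12 /div d12]]] := ideal1_meets_xx.
have [p13 [k13 [n13 F13 /div d13]]] := ideal1_meets_y true.
have [p23 [k23 [n23 F23 /div d23]]] := ideal1_meets_y false.
exact: (principal_unmixed s0 n12 n13 n23 F12 F13 F23 d12 d13 d23).
Qed.

Let PW1_W2 (P : R -> Prop) : (forall w, w \in W2 -> P w) -> forall w, w \in W1 -> P w.
Proof. by move=> PW2 w /W12 /PW2. Qed.

Lemma free_part_subspace F1 F2 F3 (P : R -> Prop) :
  is_ideal P -> is_subspace (fun p => P p /\ free_poly F1 F2 F3 p).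
Proof.
move=> idP; have [FB FZ] := free_poly_subspace K F1 F2 F3.
have [PB PZ] := ideal_subspace idP.
split=> [p q [Pp Fp] [Pq Fq]|c p [Pp Fp]]; first by split; [apply: PB | apply: FB].
by split; [apply: PZ | apply: FZ].
Qed.

Lemma stab_free_part F1 F2 F3 (P : R -> Prop) g :
  stab P g -> stab (fun p => P p /\ free_poly F1 F2 F3 p) g.
Proof. by move=> stabg p [Pp Fp]; split; [apply: stabg | apply: trans_free]. Qed.

(** Otherwise W2 is contained in a prime ideal without nonzero polynomial in y.
It contains a polynomial in x1, y and one in x2, y, whose existence forces a
stabilising translation to fix x1 and x2. *)
Lemma ideal2_meets_y : exists p k,
  [/\ p != 0, free_poly false false true p & generated W2 (y ^+ k * p)].
Proof.
case: (generated_meets_or_prime false false true W2) => // -[P [prP PW2 nPy noF]].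
have idP : is_ideal P := prP; have PW1 := PW1_W2 PW2.
have fixed (b : bool) g : stab P g -> (if b then coordX1 g else coordX2 g) = 0.
  move=> stabg; have [p [k [n0 Fp Ip]]] := ideal1_meets_y b.
  have Pp : P p := prime_generated prP PW1 nPy Ip.
  have [||[a1 a2] /= [a0 line a2_0 a1_0]] :=
      stab_line charK0 (free_part_subspace b (~~ b) true idP).
  - by exists p.
  - by move=> q [Pq _] Fq; apply: noF.
  move: (line g (stab_free_part stabg)); case: b Fp a2_0 a1_0 {line} => /= _ a2_0 a1_0.
    have {}a2_0 : a2 = 0 by apply: a2_0 => q [].
    rewrite a2_0 mul0r addr0 => /eqP; rewrite mulf_eq0 => /orP [/eqP a1_0'|/eqP //].
    by case: a0; rewrite a1_0' a2_0.
  have {}a1_0 : a1 = 0 by apply: a1_0 => q [].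
  rewrite a1_0 mul0r add0r => /eqP; rewrite mulf_eq0 => /orP [/eqP a2_0'|/eqP //].
  by case: a0; rewrite a1_0 a2_0'.
have [J [g [cardJ S2g neqg]]] := fset_representatives S2
  (fun g => (coordX1 g, coordX2 g)).
have : (#|J| <= 2 * (K1 * K2 * 1))%N.
  apply: (bezout_codim2 (F1 := false) (F2 := false) (F3 := true) _ regular_W1 prP PW2 S2g)
    => // i j neq_ij stabg; apply: (neqg i j neq_ij).
  have := fixed true _ stabg; have := fixed false _ stabg.
  have [-> -> _] := coordB (g i) (g j).
  by move=> /subr0_eq -> /subr0_eq ->.
by rewrite cardJ muln1 mulnA leqNgt S2_xx.
Qed.

(** Otherwise W2 is contained in the ideal of a curve that lies in a plane
y = z, so that a stabilising translation fixes y and moves x along one line. *)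
Lemma ideal2_meets_x (b : bool) : exists p k,
  [/\ p != 0, free_poly b (~~ b) false p & generated W2 (y ^+ k * p)].
Proof.
case: (generated_meets_or_prime b (~~ b) false W2) => // -[P [prP PW2 nPy noF]].
have idP : is_ideal P := prP; have PW1 := PW1_W2 PW2.
have consts c : P (cst c) -> c = 0.
  move=> Pc; case: (eqVneq c 0) => // c0; case: (prime1 prP).
  by rewrite -(rmorph1 cst) -(mulVf c0) rmorphM; apply: (idealM idP).
(* The component lies in a plane y = z with z nonzero. *)
have [z Pz] : exists z, P (y - cst z).
  apply: boolp.contrapT => noz; apply: (prime1 prP).
  have [p3 [k3 [n3 F3 I3]]] := ideal2_meets_y.
  have P3 : P p3 := prime_generated prP PW2 nPy I3.
  have [_ sz2 sz1] := (free_polyP false false true p3).1 F3.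
  pose phi : {rmorphism {poly K} -> R} := map_poly (polyC \o polyC).
  pose w := \poly_(k < size p3) p3`_k`_0`_0.
  have p3E : p3 = phi w.
    apply/polyP => k; rewrite coef_map coef_poly /=; case: ltnP => [_|le_k].
      by rewrite {1}(size1_polyC (sz2 k)) {1}(size1_polyC (sz1 k 0%N)).
    by rewrite nth_default.
  apply: (strip_linear_factors (phi := phi) (G := fun=> True) (c := w) idP) => //.
  - move=> z b' _ /(primeM prP) [] // Pz; case: noz; exists z.
    by move: Pz; rewrite rmorphB /= map_polyX map_polyC.
  - by apply: contra_neq n3 => w0; rewrite p3E w0 rmorph0.
  - by rewrite -p3E mulr1.
have z0 : z != 0 by apply/eqP => z0; apply: nPy; rewrite z0 rmorph0 subr0 in Pz.
have fix_y g : stab P g -> coordY g = 1.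
  have alg (A : comNzRingType) (a c w : A) : (a * w - c) - a * (w - c) = (a - 1) * c by ring.
  move=> /(_ _ Pz); rewrite rmorphB trans_y trans_cst => Ptz.
  have Pc : P (cst ((coordY g - 1) * z)).
    have -> : cst ((coordY g - 1) * z) =
        (cst (coordY g) * y - cst z) - cst (coordY g) * (y - cst z).
      by rewrite alg (rmorphM cst) (rmorphB cst) (rmorph1 cst).
    by apply: (idealB idP) => //; apply: (idealM idP).
  by move/consts/eqP: Pc; rewrite mulf_eq0 (negPf z0) orbF subr_eq0 => /eqP.
have [p12 [k12 [n12 F12 I12]]] := ideal1_meets_xx.
have P12 : P p12 := prime_generated prP PW1 nPy I12.
have [||ab [ab0 line _ _]] := stab_line charK0 (free_part_subspace true true false idP).
- by exists p12.
- move=> p [Pp /free_polyP [p3 _ _]] /free_polyP [_ p2 p1]; apply: noF => //.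
  by apply/free_polyP; split=> [//|k|k j]; apply/orP; right; [apply: p2 | apply: p1].
have [J [g [cardJ S2g neqg]]] := fset_representatives S2
  (fun g => (ab.1 * coordX1 g + ab.2 * coordX2 g, coordY g)).
have : (#|J| <= 2 * ((if b then 1 else K1) * (if ~~ b then 1 else K2) * L))%N.
  apply: (bezout_codim2 (F1 := b) (F2 := ~~ b) (F3 := false) _ regular_W1 prP PW2 S2g)
    => //; first by case: (b).
  move=> i j neq_ij stabg; apply: (neqg i j neq_ij).
  have := fix_y _ stabg; have := line _ (stab_free_part stabg).
  have [-> -> ->] := coordB (g i) (g j) => eq0 eq1; congr (_, _).
    by apply/eqP; rewrite -subr_eq0 -eq0; apply/eqP; ring.
  by rewrite -[LHS](divfK (coordY_neq0 (g j))) eq1 mul1r.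
have : ((if b then 1 else K1) * (if ~~ b then 1 else K2) <= maxn K1 K2)%N.
  by case: (b); rewrite /= ?mul1n ?muln1 ?leq_maxr ?leq_maxl.
have : (2 * maxn K1 K2 * L < #|J|)%N.
  by rewrite cardJ; apply: S2_xy => ab0'; apply: ab0; rewrite -ab0'; case: (ab).
move=> lt1 le2 le3.
have := leq_trans lt1 (leq_trans le3 (leq_mul (leqnn 2) (leq_mul le2 (leqnn L)))).
by rewrite mulnA ltnn.
Qed.

Lemma koszul_W1 : koszul s%:P (generic W1).
Proof.
apply: koszul_regular => [|a]; first by rewrite polyC_eq0.
move=> /principal_polyC diva; apply/principal_polyC.
apply: (mccoy (principal_ideal s) _ diva) => c divc; apply: regular_W1 => w Ww.
by have := divc (index w W1); rewrite coef_poly index_mem Ww nth_index.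
Qed.

Lemma regular_W2 (c : {poly R}) :
  (forall w, w \in W2 -> saturation y s W1 (c * w%:P)) -> saturation y s W1 c.
Proof.
have [p1 [k1 [n1 F1 I1]]] := ideal2_meets_x true.
have [p2 [k2 [n2 F2 I2]]] := ideal2_meets_x false.
have [p3 [k3 [n3 F3 I3]]] := ideal2_meets_y.
have sP0 : s%:P != 0 by rewrite polyC_eq0.
apply: (regular_saturation _ I1 I2 I3) => f.
exact: (ideal2_unmixed_poly sP0 koszul_W1 n1 n2 n3 F1 F2 F3).
Qed.

Lemma evalR_prime (q : grpG K) : is_prime (fun p : R => evalR q p = 0).
Proof.
split=> [|/eqP|a b /eqP].
- split=> [|a b a0 b0|a b b0]; first exact: rmorph0.
    by rewrite rmorphD a0 b0 addr0.
  by rewrite rmorphM b0 mulr0.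
- by rewrite rmorph1 oner_eq0.
- by rewrite rmorphM mulf_eq0 => /orP [] /eqP; [left | right].
Qed.

Lemma evalR_separates (q q' : grpG K) : q != q' ->
  exists p : R, evalR q' p = 0 /\ evalR q p <> 0.
Proof.
move=> neq; apply: boolp.contrapT => nosep.
have eqev : evalR q =1 evalR q'.
  apply: boolp.contrapT => /morphism_separates sep; apply: nosep; apply: sep => c.
    exact: (evalR_cst q).
  exact: (evalR_cst q').
case/eqP: neq.
have e1 : q.1.1 = q'.1.1 by rewrite -[LHS]evalR_x1 eqev evalR_x1.
have e2 : q.1.2 = q'.1.2 by rewrite -[LHS]evalR_x2 eqev evalR_x2.
have e3 : q.2 = q'.2 by apply: val_inj; rewrite -[LHS]evalR_y eqev evalR_y.
by case: q q' e1 e2 e3 {nosep eqev} => [[? ?] ?] [[? ?] ?] /= -> -> ->.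
Qed.

Lemma card_common_zeros :
  (forall q w, q \in S3 -> w \in W2 -> evalR q w = 0) -> (#|` S3| <= 6 * K1 * K2 * L)%N.
Proof.
move=> zero_W2; pose P (q : S3) (p : R) := evalR (val q) p = 0.
have prP q : is_prime (P q) by apply: evalR_prime.
have idV : is_ideal (fun p => forall q, P q p).
  split=> [q|a b Pa Pb q|a b Pb q]; first exact: (ideal0 (prP q)).
    exact: (idealD (prP q)).
  exact: (idealM (prP q)).
have VW2 w : w \in W2 -> forall q, P q w.
  by move=> Ww q; apply: zero_W2 => //; apply: valP.
have VW1 w : w \in W1 -> forall q, P q w by move=> /W12 /VW2.
have Vy a : (forall q, P q (y * a)) -> forall q, P q a.
  move=> Pya q; case: (primeM (prP q) (Pya q)) => // /eqP.
  by rewrite evalR_y (negPf (coordY_neq0 _)).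
have := @bezout_primes K false false false K1 K2 L n 1 S3 P (fun=> 1).
rewrite muln1 -cardfE !mulnA; apply=> //.
- by move=> q q' neq; apply: evalR_separates; rewrite (inj_eq val_inj).
- move=> q f Ff; rewrite big_ord1 mulr1 => Pf l; rewrite ord1.
  have := Ff 0; move: Pf; rewrite /P; move: (f 0) => {f Ff} f Pf /free_polyP [f3 f2 f1].
  have fE : f = cst f`_0`_0`_0.
    by rewrite {1}(size1_polyC f3) {1}(size1_polyC (f2 0%N)) {1}(size1_polyC (f1 0%N 0%N)).
  by move: Pf; rewrite fE evalR_cst => ->; apply: (rmorph0 cst).
- exact: (chain3 B0 box_s BW1 BW2 (leq_maxl _ _) (leq_maxr _ _) s0 idV (VW1 s W1s)
    VW1 regular_W1 Vy VW2 regular_W2).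
Qed.

End ZeroEstimate.

Lemma split_powers_X (A : nzRingType) (p : {poly A}) : p != 0 ->
  exists k q, [/\ p = q * 'X^k, q`_0 != 0 & forall i, q`_i = p`_(i + k)].
Proof.
move=> p0; have [|k [pk mink]] := @ex_minimal _ id (fun k => p`_k != 0).
  by exists (size p).-1; rewrite -lead_coefE lead_coef_eq0.
pose q := \poly_(i < size p) p`_(i + k).
have qE i : q`_i = p`_(i + k).
  rewrite coef_poly; case: ltnP => // le_i.
  by rewrite nth_default // (leq_trans le_i) // leq_addr.
exists k, q; split=> //; last by rewrite qE.
apply/polyP => i; rewrite coefMXn qE; case: ltnP => [lt_ik|le_ki]; last by rewrite subnK.
by apply/eqP; apply: contraTT lt_ik => pi0; rewrite -leqNgt; apply: mink.
Qed.

Theorem propositionA1 (K : closedFieldType) (charK0 : [pchar K] =i pred0)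
    (K1 K2 L : nat) (S1 S2 S3 : {fset grpG K})
    (S1_0 : 0 \in S1) (S2_0 : 0 \in S2) (S3_0 : 0 \in S3)
    (S1_x : forall a b : K, (a, b) <> (0, 0) ->
       (#|` [fset (a * coordX1 g + b * coordX2 g)%R | g in S1] |
          > maxn K1 K2)%N)
    (S1_y : (#|` [fset coordY g | g in S1] | > L)%N)
    (S2_xy : forall a b : K, (a, b) <> (0, 0) ->
       (#|` [fset (a * coordX1 g + b * coordX2 g, coordY g)%R | g in S2] |
          > 2 * maxn K1 K2 * L)%N)
    (S2_xx : (#|` [fset (coordX1 g, coordX2 g) | g in S2] | > 2 * K1 * K2)%N)
    (S3_card : (#|` S3| > 6 * K1 * K2 * L)%N)
    (s : {mpoly K[3]}) (s_neq0 : s != 0)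
    (s_X1 : (pdeg (inord 0) s <= K1)%N)
    (s_X2 : (pdeg (inord 1) s <= K2)%N)
    (s_Y : (pdeg (inord 2) s <= L)%N) :
  ~ (forall g, g \in sumset (sumset S1 S2) S3 -> s.@[coords g] = 0).
Proof.
move=> s_zero.
(* A power of y has no zero in G, so it may be removed from s. *)
have [k [r [sE r0 rE]]] := split_powers_X (of_mpoly_neq0 s_neq0).
have box_r : box K1.+1 K2.+1 L.+1 r.
  have [sz3 b2] := of_mpoly_box s_X1 s_X2 s_Y; split=> [|i]; last by rewrite rE.
  apply/leq_sizeP => i le_i; rewrite rE nth_default // (leq_trans sz3) //.
  exact: leq_trans le_i (leq_addr _ _).
have := card_common_zeros charK0 S1_0 S2_0 S1_x S1_y S2_xy S2_xx box_r r0 (S3 := S3).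
rewrite leqNgt S3_card => /(_ _)/negP; apply=> //.
move=> q _ S3q /allpairsP [[g h] [S1g S2h ->]].
rewrite evalR_trans; set p := q + _.
have : evalR p (of_mpoly s) = 0.
  rewrite evalR_of_mpoly; apply: s_zero; rewrite /p addrC.
  by apply: in_imfset2 => //; apply: in_imfset2.
rewrite sE (rmorphM (evalR p)) => /eqP; rewrite mulf_eq0 => /orP [/eqP //|].
by rewrite (rmorphXn (evalR p)) evalR_y expf_eq0 (negPf (coordY_neq0 p)) andbF.
Qed.
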